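(* Let $X$ be the blow-up of $\mathbb{P}^2$ at one point over an algebraically closed field of characteristic $0$, let $D\subset X$ be an irreducible curve, and let $\epsilon=1-1/m$ with $m\ge2$ an integer. If $-(K_X+\epsilon D)$ is nef, then the class of $D$ is one of the following, and the positivity of $-(K_X+\epsilon D)$ is as stated; classes are listed with $(-K_X\cdot D,\ D^2,\ D\cdot E,\ D\cdot f)$. (a) $-(K_X+\epsilon D)$ is ample for every $m\ge2$: $E$ $(1,-1,-1,1)$; $f=H-E$ $(2,0,1,0)$; $H$ $(3,1,0,1)$; $2H-E$ $(5,3,1,1)$; $2H$ $(6,4,0,2)$; $-K_X=3H-E$ $(8,8,1,2)$. (b) $-(K_X+\epsilon D)$ is ample if and only if $m=2$, nef if and only if $m\in\{2,3\}$, and big if and only if $m=2$: $3H$ $(9,9,0,3)$; $4H-E$ $(11,15,1,3)$. (c) $-(K_X+\epsilon D)$ is nef if and only if $m=2$, never ample, and big for $m=2$: $3H-2E$ $(7,5,2,1)$; $4H-2E$ $(10,12,2,2)$; $5H-2E$ $(13,21,2,3)$. (d) $-(K_X+\epsilon D)$ is nef if and only if $m=2$, never ample, and not big for $m=2$: $4H$ $(12,16,0,4)$; $5H-E$ $(14,24,1,4)$; $-2K_X=6H-2E$ $(16,32,2,4)$. Conversely, every class listed is represented by an irreducible curve. In particular $-(K_X+\epsilon D)$ is ample exactly for the six classes in (a), for every $m\ge2$, and for the two classes in (b), for $m=2$.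
   Context: $H$ is the pullback of the hyperplane class of $\mathbb{P}^2$, $E$ the exceptional curve, $f:=H-E$ the fibre class of the ruling, and $K_X=-3H+E$. *)

(* Defs.v *)
From HB Require Import structures.
From mathcomp Require Import all_boot all_order all_algebra.
From mathcomp Require Import mpoly.
Set Implicit Arguments.
Unset Strict Implicit.
Unset Printing Implicit Defensive.
Import Order.TTheory GRing.Theory Num.Theory.
Local Open Scope ring_scope.

(* The blow-up of P^2 at the point [0:0:1] is the surface
   X = { ([x0:x1:x2], [u0:u1]) | x0 * u1 = x1 * u0 } in P^2 x P^1,
   with the first projection as blow-down and the second one as ruling.  Its
   points are handled through pairs (x, u) of nonzero homogeneous coordinate
   vectors; subsets of X are predicates on such pairs. *)

Definition point (k : closedFieldType) : Type := ('rV[k]_3 * 'rV[k]_2)%type.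

Definition onX (k : closedFieldType) (q : point k) : Prop :=
  [/\ q.1 != 0, q.2 != 0 &
      q.1 0 (inord 0) * q.2 0 (inord 1) = q.1 0 (inord 1) * q.2 0 (inord 0)].

(* The first three indeterminates are the coordinates on P^2, the last two
   those on P^1. *)
Definition bihomog (k : closedFieldType) (a b : nat) (P : {mpoly k[3 + 2]}) :
    Prop :=
  forall m, m \in msupp P ->
    \sum_(i < 3) m (lshift 2 i) = a /\ \sum_(j < 2) m (rshift 3 j) = b.

Definition is_bihomog (k : closedFieldType) (P : {mpoly k[3 + 2]}) : Prop :=
  exists a b, bihomog a b P.

Definition ev (k : closedFieldType) (P : {mpoly k[3 + 2]}) (q : point k) : k :=
  P.@[fun i => row_mx q.1 q.2 0 i].

Definition subX (k : closedFieldType) : Type := point k -> Prop.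

Definition incl (k : closedFieldType) (Y Z : subX k) : Prop :=
  forall q, Y q -> Z q.

Definition zclosed (k : closedFieldType) (Z : subX k) : Prop :=
  exists S : {mpoly k[3 + 2]} -> Prop,
    (forall P, S P -> is_bihomog P) /\
    (forall q, Z q <-> onX q /\ forall P, S P -> ev P q = 0).

Definition zirreducible (k : closedFieldType) (Z : subX k) : Prop :=
  [/\ zclosed Z, (exists q, Z q) &
      forall Y1 Y2 : subX k, zclosed Y1 -> zclosed Y2 ->
        (forall q, Z q -> Y1 q \/ Y2 q) -> incl Z Y1 \/ incl Z Y2].

Definition strict_incl (k : closedFieldType) (Y Z : subX k) : Prop :=
  incl Y Z /\ ~ incl Z Y.

(* Irreducible closed subsets of Krull dimension 1. *)
Definition irreducible_curve (k : closedFieldType) (D : subX k) : Prop :=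
  [/\ zirreducible D,
      (exists Y : subX k, zirreducible Y /\ strict_incl Y D) &
      ~ (exists Y1 Y2 : subX k, [/\ zirreducible Y1, zirreducible Y2,
           strict_incl Y1 Y2 & strict_incl Y2 D])].

(* Pic X = Z H + Z E; the pair (a, b) stands for the class a H + b E. *)
Definition cls : Type := (int * int)%type.

Definition H : cls := (1, 0).
Definition E : cls := (0, 1).
Definition f : cls := H - E.
Definition KX : cls := E - H *+ 3.

(* H^2 = 1, H.E = 0, E^2 = -1 *)
Definition inter (R : comNzRingType) (L M : R * R) : R :=
  L.1 * M.1 - L.2 * M.2.

(* Since H and f = H - E are the pullbacks of the hyperplane classes of P^2 and
   P^1, the class a H + b E = (a + b) H - b f is that of the restriction to X of
   O(a + b, - b).  Hence a global section is a function on the coordinate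
   vectors of points of X which near every point is a quotient of bihomogeneous
   polynomials whose bidegrees differ by (a + b, - b). *)
Definition section (k : closedFieldType) (L : cls) (s : point k -> k) : Prop :=
  forall q, onX q ->
    exists (P Q : {mpoly k[3 + 2]}) (a b c d : nat),
      [/\ bihomog a b P, bihomog c d Q,
          (a%:Z = c%:Z + (L.1 + L.2) /\ b%:Z = d%:Z - L.2), ev Q q != 0 &
          forall q', onX q' -> ev Q q' != 0 -> s q' = ev P q' / ev Q q'].

(* The class of the curve D is L when O_X(D) = L, i.e. when some section of L
   generates the (reduced) ideal of D near every point of X. *)
Definition has_class (k : closedFieldType) (D : subX k) (L : cls) : Prop :=
  exists s : point k -> k,
    [/\ section L s,
        (forall q, D q -> s q = 0) &
        forall G : {mpoly k[3 + 2]}, is_bihomog G ->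
          (forall q, D q -> ev G q = 0) ->
          forall q, onX q ->
            exists A B : {mpoly k[3 + 2]},
              [/\ is_bihomog A, is_bihomog B, ev A q != 0 &
                  forall q', onX q' -> ev A q' * ev G q' = s q' * ev B q']].

(* h^0(X, L) >= n *)
Definition h0_ge (k : closedFieldType) (L : cls) (n : nat) : Prop :=
  exists s : 'I_n -> point k -> k,
    (forall i, section L (s i)) /\
    (forall c : 'I_n -> k,
       (forall q, onX q -> \sum_i c i * s i q = 0) -> forall i, c i = 0).

(* The sections s_0, ..., s_(N-1) define a morphism from X to P^(N-1), which is
   an isomorphism onto its image: near every point of the image the inverse is
   given by tuples of homogeneous polynomials Ax and Au of the same degree.  The
   image is closed because X is projective. *)
Definition very_ample (k : closedFieldType) (L : cls) : Prop :=
  exists (N : nat) (s : 'I_N -> point k -> k),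
    [/\ (forall i, section L (s i)),
        (forall q, onX q -> exists i, s i q != 0) &
        forall q, onX q ->
          exists (dx du : nat)
                 (Ax : 'I_3 -> {mpoly k[N]}) (Au : 'I_2 -> {mpoly k[N]}),
            [/\ (forall i m, m \in msupp (Ax i) -> mdeg m = dx),
                (forall j m, m \in msupp (Au j) -> mdeg m = du),
                (exists i, (Ax i).@[fun l => s l q] != 0),
                (exists j, (Au j).@[fun l => s l q] != 0) &
                forall q', onX q' -> exists lx lu : k,
                  (forall i, (Ax i).@[fun l => s l q'] = lx * q'.1 0 i) /\
                  (forall j, (Au j).@[fun l => s l q'] = lu * q'.2 0 j)]].

Definition ample (k : closedFieldType) (L : cls) : Prop :=
  exists n : nat, (0 < n)%N /\ very_ample k (L *+ n).

(* limsup h^0(X, n L) / n^2 > 0 *)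
Definition big (k : closedFieldType) (L : cls) : Prop :=
  exists N : nat, (0 < N)%N /\
    forall n0 : nat, exists n r : nat,
      [/\ (n0 <= n)%N, (n ^ 2 <= N * r)%N & h0_ge k (L *+ n) r].

Definition Qcls : Type := (rat * rat)%type.

Definition toQ (L : cls) : Qcls := (L.1%:~R, L.2%:~R).

Definition Qnef (k : closedFieldType) (L : Qcls) : Prop :=
  forall (C : subX k) (c : cls), irreducible_curve C -> has_class C c ->
    0 <= inter L (toQ c).

(* A Q-divisor class is ample (resp. big) when some positive multiple of it is
   the class of an ample (resp. big) line bundle. *)
Definition Qample (k : closedFieldType) (L : Qcls) : Prop :=
  exists (n : nat) (M : cls), [/\ (0 < n)%N, toQ M = L *+ n & ample k M].

Definition Qbig (k : closedFieldType) (L : Qcls) : Prop :=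
  exists (n : nat) (M : cls), [/\ (0 < n)%N, toQ M = L *+ n & big k M].

(* - (K_X + eps D) with eps = 1 - 1/m, where D has class c *)
Definition neglogK (m : nat) (c : cls) : Qcls :=
  let eps : rat := 1 - m%:R^-1 in
  - (toQ KX + (eps * (toQ c).1, eps * (toQ c).2)).

(* (- K_X . D, D^2, D . E, D . f) *)
Definition numbers (c : cls) : int * int * int * int :=
  (inter (- KX) c, inter c c, inter c E, inter c f).

Definition table_a : seq (cls * (int * int * int * int)) :=
  [:: (E,            (1, -1, -1, 1));
      (f,            (2, 0, 1, 0));
      (H,            (3, 1, 0, 1));
      (H *+ 2 - E,   (5, 3, 1, 1));
      (H *+ 2,       (6, 4, 0, 2));
      (H *+ 3 - E,   (8, 8, 1, 2))].

Definition table_b : seq (cls * (int * int * int * int)) :=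
  [:: (H *+ 3,       (9, 9, 0, 3));
      (H *+ 4 - E,   (11, 15, 1, 3))].

Definition table_c : seq (cls * (int * int * int * int)) :=
  [:: (H *+ 3 - E *+ 2, (7, 5, 2, 1));
      (H *+ 4 - E *+ 2, (10, 12, 2, 2));
      (H *+ 5 - E *+ 2, (13, 21, 2, 3))].

Definition table_d : seq (cls * (int * int * int * int)) :=
  [:: (H *+ 4,          (12, 16, 0, 4));
      (H *+ 5 - E,      (14, 24, 1, 4));
      (H *+ 6 - E *+ 2, (16, 32, 2, 4))].

Definition classes_a : seq cls := unzip1 table_a.
Definition classes_b : seq cls := unzip1 table_b.
Definition classes_c : seq cls := unzip1 table_c.
Definition classes_d : seq cls := unzip1 table_d.

(* Main.v *)
Require Import Defs.
From HB Require Import structures.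
From mathcomp Require Import all_boot all_order all_algebra.
From mathcomp Require Import mpoly.
From mathcomp Require Import ring lra zify.
From Stdlib Require Import Classical.
Set Implicit Arguments.
Unset Strict Implicit.
Unset Printing Implicit Defensive.
Import Order.TTheory GRing.Theory Num.Theory.
Local Open Scope ring_scope.

(* Every point of X is (e u0, e u1, z; u0, u1) with u and (e, z) nonzero, so that
   sections of a H + b E restrict to binary forms of degree - b on E, a + b on a
   fibre and a on the line z = 0.  Hence an irreducible curve of class a H + b E
   is E if b > 0, a fibre if a + b <= 0, and otherwise has b <= 0 < a + b.  So
   L is nef iff L.E, L.f >= 0; it is ample iff both are positive, since sections
   of nonpositive degree on E or on a fibre do not separate points there; and
   h^0(nL) grows at most linearly if L.f <= 0.  The condition on - (K_X + eps D)
   thus becomes 1 + eps b >= 0 and 2 - eps (a + b) >= 0.  For p >= 1 the class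
   (p + c) H - c E is represented by z^p u0^c = e^p u1 (u0 + u1)^(p + c - 1),
   which is irreducible by Eisenstein's criterion at u1 = 0. *)

(** * Coordinates and bihomogeneous polynomials *)

Arguments bihomog [k] (a b)%_N P.

(** Intersection numbers enter only as degrees of binary forms: a section is restricted to a
    parametrised copy of P^1 ([E], a fibre, the line z = 0), where a homogeneous function that is
    locally a quotient of polynomials must be a polynomial. The class of [E] or of a fibre is then
    found by counting zeros: one simple zero on a transverse curve, no vanishing along a disjoint
    one. The existence part has to meet [has_class], which asks for a local generator of the ideal
    of the curve, not just for an equation. This and irreducibility come from one dichotomy: the
    dehomogenisation of a bihomogeneous G is a multiple of the equation in k[y][w], or G meets the
    curve in finitely many points. In that equation u1 is the simple zero needed for Eisenstein's
    criterion, and the power of u0 + u1, a unit at u1 = 0, only brings the degree in u up to p + c.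
    Characteristic 0 ensures that 2^p is not 1 in k; irreducibility is proved by comparing two
    substitutions, with a = 1 and a = 2. *)

Definition vec3 (R : Type) (a b c : R) : 'rV[R]_3 :=
  \row_i (if i == 0 :> nat then a else if i == 1%N :> nat then b else c).
Definition vec2 (R : Type) (a b : R) : 'rV[R]_2 :=
  \row_i (if i == 0 :> nat then a else b).
Definition row5 (R : Type) (a b c d e : R) : 'rV[R]_(3 + 2) :=
  row_mx (vec3 a b c) (vec2 d e).

Definition pt (k : closedFieldType) (a b c d e : k) : point k :=
  (vec3 a b c, vec2 d e).

(* The point with Cox coordinates (u0, u1, z) and e, the equation of E. *)
Definition cox (k : closedFieldType) (u0 u1 e z : k) : point k :=
  pt (e * u0) (e * u1) z u0 u1.

Definition ix0 : 'I_(3 + 2) := lshift 2 (inord 0).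
Definition ix1 : 'I_(3 + 2) := lshift 2 (inord 1).
Definition ix2 : 'I_(3 + 2) := lshift 2 (inord 2).
Definition iu0 : 'I_(3 + 2) := rshift 3 (inord 0).
Definition iu1 : 'I_(3 + 2) := rshift 3 (inord 1).

Lemma row5E (R : Type) (a b c d e : R) :
  (row5 a b c d e 0 ix0 = a) * (row5 a b c d e 0 ix1 = b)
  * (row5 a b c d e 0 ix2 = c) * (row5 a b c d e 0 iu0 = d)
  * (row5 a b c d e 0 iu1 = e).
Proof. by rewrite /row5 !row_mxEl !row_mxEr !mxE !inordK. Qed.

Lemma map_row5 (R S : Type) (g : R -> S) (a b c d e : R) (i : 'I_(3 + 2)) :
  row5 (g a) (g b) (g c) (g d) (g e) 0 i = g (row5 a b c d e 0 i).
Proof.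
by rewrite /row5 !mxE; case: split => j; rewrite !mxE; do ?case: ifP.
Qed.

Lemma ptP (k : closedFieldType) (q : point k) :
  exists a b c d e, q = pt a b c d e.
Proof.
case: q => x u; exists (x 0 (inord 0)), (x 0 (inord 1)), (x 0 (inord 2)),
  (u 0 (inord 0)), (u 0 (inord 1)).
rewrite /pt; congr (_, _); apply/rowP => i; rewrite !mxE.
  case: i => [[|[|[|//]]] Hi] /=; congr (x _ _); apply/val_inj;
  by rewrite /= inordK.
case: i => [[|[|//]] Hi] /=; congr (u _ _); apply/val_inj;
by rewrite /= inordK.
Qed.

Lemma vec3_eq0 (R : nmodType) (a b c : R) :
  (vec3 a b c == 0) = [&& a == 0, b == 0 & c == 0].
Proof.
apply/eqP/and3P => [/rowP h|[/eqP-> /eqP-> /eqP->]].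
  have := h 0; have := h (inord 1); have := h (inord 2).
  by rewrite !mxE !inordK //= => -> -> ->.
by apply/rowP => i; rewrite !mxE; do ?case: ifP.
Qed.

Lemma vec2_eq0 (R : nmodType) (a b : R) : (vec2 a b == 0) = (a == 0) && (b == 0).
Proof.
apply/eqP/andP => [/rowP h|[/eqP-> /eqP->]].
  by have := h 0; have := h (inord 1); rewrite !mxE !inordK //= => -> ->.
by apply/rowP => i; rewrite !mxE; do ?case: ifP.
Qed.

Lemma onX_pt (k : closedFieldType) (a b c d e : k) :
  onX (pt a b c d e) <->
  [/\ ~~ [&& a == 0, b == 0 & c == 0], ~~ ((d == 0) && (e == 0)) &
      a * e = b * d].
Proof. by rewrite /onX /= vec3_eq0 vec2_eq0 !mxE !inordK. Qed.

Lemma onX_cox (k : closedFieldType) (u0 u1 e z : k) :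
  onX (cox u0 u1 e z) <->
  ~~ ((u0 == 0) && (u1 == 0)) /\ ~~ ((e == 0) && (z == 0)).
Proof.
rewrite onX_pt; split => [[h1 h2 _]|[h1 h2]].
  split=> //; apply: contra h1 => /andP[/eqP-> ->].
  by rewrite !mul0r eqxx.
split=> //; last by ring.
apply: contra h2 => /and3P[]; rewrite !mulf_eq0 => a b ->.
rewrite andbT; move: a b h1.
by case: (e == 0) => //= -> ->.
Qed.

Lemma onX_coxP (k : closedFieldType) (q : point k) : onX q ->
  exists u0 u1 e z, [/\ q = cox u0 u1 e z, ~~ ((u0 == 0) && (u1 == 0)) &
    ~~ ((e == 0) && (z == 0))].
Proof.
have [a [b [c [d [e ->]]]]] := ptP q => hX.
suff [t E] : exists t, pt a b c d e = cox d e t c.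
  by exists d, e, t, c; rewrite E; move: hX; rewrite E onX_cox => -[].
have /onX_pt[h1 h2 h3] := hX.
have [d0|d0] := eqVneq d 0.
  rewrite d0 eqxx /= in h2; exists (b / e); rewrite /cox divfK // d0 mulr0.
  by congr pt; apply: (mulIf h2); rewrite h3 d0 mul0r mulr0.
exists (a / d); rewrite /cox divfK //; congr pt; apply: (mulIf d0).
by rewrite -h3; field.
Qed.

Section Pull.
Variables (k : closedFieldType) (A : comNzRingType) (i : {rmorphism k -> A}).

(** Used with A = k[t] for paths in X and with A = k[y][w] for an affine chart; specialising A to k
    turns it into evaluation at a point. *)
Definition pull (a b c d e : A) (P : {mpoly k[3 + 2]}) : A :=
  mmap i (fun l => row5 a b c d e 0 l) P.

Lemma pullP (phi : {rmorphism A -> k}) (a b c d e : A) P :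
  (forall x, phi (i x) = x) ->
  phi (pull a b c d e P) = ev P (pt (phi a) (phi b) (phi c) (phi d) (phi e)).
Proof.
move=> h; rewrite /pull /mmap /ev mevalE rmorph_sum; apply: eq_bigr => m _.
rewrite rmorphM h; congr (_ * _); rewrite rmorph_prod; apply: eq_bigr => l _.
by rewrite rmorphXn -map_row5.
Qed.

End Pull.

Section Ev.
Variable k : closedFieldType.
Implicit Types (P Q : {mpoly k[3 + 2]}) (q : point k).

Lemma evM P Q q : ev (P * Q) q = ev P q * ev Q q.
Proof. by rewrite /ev rmorphM. Qed.
Lemma evD P Q q : ev (P + Q) q = ev P q + ev Q q.
Proof. by rewrite /ev rmorphD. Qed.
Lemma evB P Q q : ev (P - Q) q = ev P q - ev Q q.
Proof. by rewrite /ev rmorphB. Qed.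
Lemma evN P q : ev (- P) q = - ev P q.
Proof. by rewrite /ev rmorphN. Qed.
Lemma evXn P n q : ev (P ^+ n) q = ev P q ^+ n.
Proof. by rewrite /ev rmorphXn. Qed.
Lemma evZ c P q : ev (c *: P) q = c * ev P q.
Proof. by rewrite /ev mevalZ. Qed.
Lemma ev0 q : ev 0 q = 0. Proof. by rewrite /ev rmorph0. Qed.
Lemma ev1 q : ev 1 q = 1. Proof. by rewrite /ev rmorph1. Qed.
Lemma ev_sum I r (p : pred I) (F : I -> {mpoly k[3 + 2]}) q :
  ev (\sum_(i <- r | p i) F i) q = \sum_(i <- r | p i) ev (F i) q.
Proof. by rewrite /ev rmorph_sum. Qed.

Lemma evX i (a b c d e : k) : ev 'X_i (pt a b c d e) = row5 a b c d e 0 i.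
Proof. by rewrite /ev mevalXU. Qed.

Definition evE := (evM, evD, evB, evN, evXn, evZ, ev0, ev1, evX, row5E).

(** * Bidegrees and rescaling of coordinate vectors *)

Definition wx (m : 'X_{1..3 + 2}) := (\sum_(i < 3) m (lshift 2 i))%N.
Definition wu (m : 'X_{1..3 + 2}) := (\sum_(j < 2) m (rshift 3 j))%N.

Lemma wxD m m' : wx (m + m')%MM = (wx m + wx m')%N.
Proof. by rewrite -big_split; apply: eq_bigr => i _; rewrite mnmDE. Qed.
Lemma wuD m m' : wu (m + m')%MM = (wu m + wu m')%N.
Proof. by rewrite -big_split; apply: eq_bigr => i _; rewrite mnmDE. Qed.
Lemma wxU (i : 'I_(3 + 2)) : wx U_(i)%MM = (i < 3)%N.
Proof.
rewrite /wx !big_ord_recl big_ord0 !mnm1E -!val_eqE /=.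
by case: i => [[|[|[|[|[|//]]]]]].
Qed.
Lemma wuU (i : 'I_(3 + 2)) : wu U_(i)%MM = ~~ (i < 3)%N.
Proof.
rewrite /wu !big_ord_recl big_ord0 !mnm1E -!val_eqE /=.
by case: i => [[|[|[|[|[|//]]]]]].
Qed.

Lemma bihomogD a b P Q : bihomog a b P -> bihomog a b Q -> bihomog a b (P + Q).
Proof.
move=> hP hQ m /msuppD_le; rewrite mem_cat => /orP[]; [exact: hP|exact: hQ].
Qed.
Lemma bihomogN a b P : bihomog a b P -> bihomog a b (- P).
Proof. by move=> hP m; rewrite (perm_mem (msuppN _)); apply: hP. Qed.
Lemma bihomogB a b P Q : bihomog a b P -> bihomog a b Q -> bihomog a b (P - Q).
Proof. by move=> hP /bihomogN; apply: bihomogD. Qed.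
Lemma bihomogZ a b c P : bihomog a b P -> bihomog a b (c *: P).
Proof. by move=> hP m /msuppZ_le; apply: hP. Qed.
Lemma bihomog0 a b : bihomog a b (0 : {mpoly k[3 + 2]}).
Proof. by move=> m; rewrite msupp0. Qed.
Lemma bihomogM a b a' b' P Q :
  bihomog a b P -> bihomog a' b' Q -> bihomog (a + a') (b + b') (P * Q).
Proof.
move=> hP hQ m /msuppM_le /allpairsP[[m1 m2] /= [/hP[p1 p2] /hQ[q1 q2] ->]].
by have := wxD m1 m2; have := wuD m1 m2; rewrite /wx /wu p1 p2 q1 q2.
Qed.
Lemma bihomogXm (m : 'X_{1..3 + 2}) : bihomog (wx m) (wu m) ('X_[m] : {mpoly k[3 + 2]}).
Proof. by move=> m'; rewrite msuppX mem_seq1 => /eqP->. Qed.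
Lemma bihomogX (i : 'I_(3 + 2)) :
  bihomog (i < 3)%N (~~ (i < 3)%N)%N ('X_i : {mpoly k[3 + 2]}).
Proof. by have := @bihomogXm U_(i)%MM; rewrite wxU wuU. Qed.
Lemma bihomog1 : bihomog 0 0 (1 : {mpoly k[3 + 2]}).
Proof.
move=> m; rewrite -mpolyC1 msuppC oner_eq0 mem_seq1 => /eqP->.
by split; apply: big1 => i _; rewrite mnm0E.
Qed.
Lemma bihomogXn a b P n : bihomog a b P -> bihomog (n * a) (n * b) (P ^+ n).
Proof.
move=> hP; elim: n => [|n IH]; first by rewrite expr0 !mul0n; apply: bihomog1.
by rewrite exprS !mulSn; apply: bihomogM.
Qed.
Lemma bihomog_sum (I : eqType) (r : seq I) (p : pred I)
    (F : I -> {mpoly k[3 + 2]}) a b :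
  (forall i, i \in r -> p i -> bihomog a b (F i)) ->
  bihomog a b (\sum_(i <- r | p i) F i).
Proof.
move=> h; rewrite big_seq_cond; elim/big_ind: _.
- exact: bihomog0.
- by move=> P Q; apply: bihomogD.
- by move=> i /andP[]; apply: h.
Qed.

Lemma bihomog_eq a b a' b' P : bihomog a b P -> a = a' -> b = b' ->
  bihomog a' b' P.
Proof. by move=> h <- <-. Qed.

Lemma lshift_lt3 (i : 'I_3) : (lshift 2 i < 3)%N. Proof. by rewrite /=. Qed.

Lemma bihomogx (i : 'I_3) : bihomog 1 0 ('X_(lshift 2 i) : {mpoly k[3 + 2]}).
Proof. by have := @bihomogX (lshift 2 i); rewrite lshift_lt3. Qed.
Lemma bihomogu (j : 'I_2) : bihomog 0 1 ('X_(rshift 3 j) : {mpoly k[3 + 2]}).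
Proof. exact: (@bihomogX (rshift 3 j)). Qed.

Definition act (l m : k) (q : point k) : point k := (l *: q.1, m *: q.2).

Lemma act_pt l m a b c d e :
  act l m (pt a b c d e) = pt (l * a) (l * b) (l * c) (m * d) (m * e).
Proof.
by rewrite /act /pt; congr (_, _); apply/rowP => i; rewrite !mxE;
  do ?case: ifP.
Qed.

Lemma ev_act a b P l m q : bihomog a b P ->
  ev P (act l m q) = l ^+ a * m ^+ b * ev P q.
Proof.
have [x0 [x1 [x2 [u0 [u1 ->]]]]] := ptP q => hP; rewrite act_pt.
rewrite /ev !mevalE mulr_sumr; apply: eq_big_seq => n /hP[<- <-].
rewrite [in RHS]mulrCA; congr (_ * _).
have -> : \sum_(i < 3) n (lshift 2 i) = wx n by [].
rewrite !big_split_ord /= -!prodrXr mulrACA -!big_split /=.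
congr (_ * _); apply: eq_bigr => i _; rewrite !(row_mxEl, row_mxEr) !mxE -exprMn;
by do ?case: ifP.
Qed.

(** The monomials divisible by ['X_i], those of the rest divisible by ['X_j], and those free of
    both. If the two variables vanish on a curve, P agrees with P0 there; replacing them by
    proportional variables ['X_l] then divides P by an equation of the curve, which is why bidegrees
    are given for the products with ['X_l]. *)
Lemma split_two_vars (i j : 'I_(3 + 2)) a b P : bihomog a b P ->
  exists P1 P2 P0, [/\ P = 'X_i * P1 + 'X_j * P2 + P0,
    (forall l : 'I_(3 + 2), bihomog (a + (l < 3) - (i < 3))
        (b + ~~ (l < 3)%N - ~~ (i < 3)%N) ('X_l * P1)),
    (forall l : 'I_(3 + 2), bihomog (a + (l < 3) - (j < 3))
        (b + ~~ (l < 3)%N - ~~ (j < 3)%N) ('X_l * P2)),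
    bihomog a b P0 &
    forall v v' : 'I_(3 + 2) -> k, (forall l, l != i -> l != j -> v l = v' l) ->
      P0.@[v] = P0.@[v']].
Proof.
move=> hP.
have mU (l : 'I_(3 + 2)) (m : 'X_{1..3 + 2}) : m l != 0 -> m = (U_(l) + (m - U_(l)))%MM.
  move=> ml; apply/mnmP => l'; rewrite mnmDE mnmBE mnm1E.
  by case: eqVneq => [<-|]; [rewrite subnKC // lt0n|rewrite subn0].
have wU (l l' : 'I_(3 + 2)) m : m \in msupp P -> m l != 0%N ->
    bihomog (a + (l' < 3) - (l < 3)) (b + ~~ (l' < 3)%N - ~~ (l < 3)%N)
     ('X_l' * (P@_m *: 'X_[m - U_(l)]) : {mpoly k[3 + 2]}).
  move=> /hP[]; rewrite -/(wx m) -/(wu m) => wxm wum ml.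
  rewrite -scalerAr -mpolyXD; apply: bihomogZ; apply: bihomog_eq (@bihomogXm _) _ _.
    by rewrite wxD wxU -wxm [in RHS](mU _ _ ml) wxD wxU; lia.
  by rewrite wuD wuU -wum [in RHS](mU _ _ ml) wuD wuU; lia.
exists (\sum_(m <- msupp P | m i != 0%N) P@_m *: 'X_[m - U_(i)]).
exists (\sum_(m <- msupp P | (m i == 0%N) && (m j != 0%N)) P@_m *: 'X_[m - U_(j)]).
exists (\sum_(m <- msupp P | (m i == 0%N) && (m j == 0%N)) P@_m *: 'X_[m]).
split.
- rewrite {1}[P]mpolyE (bigID (fun m : 'X_{1..3 + 2} => m i == 0%N)) /=.
  rewrite [X in X + _](bigID (fun m : 'X_{1..3 + 2} => m j == 0%N)) /=.
  rewrite [RHS]addrC [X in _ = _ + X]addrC addrA; congr (_ + _); last first.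
    rewrite mulr_sumr; apply: eq_bigr => m mi.
    by rewrite -scalerAr -mpolyXD -mU.
  congr (_ + _); rewrite mulr_sumr; apply: eq_bigr => m /andP[_ mi].
  by rewrite -scalerAr -mpolyXD -mU.
- by move=> l; rewrite mulr_sumr; apply: bihomog_sum => m /wU; apply.
- move=> l; rewrite mulr_sumr; apply: bihomog_sum => m /wU h /andP[_]; exact: h.
- apply: bihomog_sum => m /hP h _; apply: bihomogZ.
  by apply: bihomog_eq (@bihomogXm _) _ _; apply h.
- move=> v v' h; rewrite !rmorph_sum; apply: eq_bigr => m /andP[/eqP mi /eqP mj].
  rewrite /= !mevalZ !mevalX; congr (_ * _); apply: eq_bigr => l _.
  have [->|li] := eqVneq l i; first by rewrite mi.
  have [->|lj] := eqVneq l j; first by rewrite mj.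
  by rewrite h.
Qed.

Lemma sectionE (L : cls) a b P : bihomog a b P -> a%:Z = L.1 + L.2 ->
  b%:Z = - L.2 -> section L (ev P).
Proof.
move=> hP ha hb q _; exists P, 1, a, b, 0%N, 0%N; split=> //.
- exact: bihomog1.
- by rewrite ha hb !add0r.
- by rewrite ev1 oner_eq0.
- by move=> q' _ _; rewrite ev1 divr1.
Qed.

Lemma onX_act l m q : l != 0 -> m != 0 -> onX q -> onX (act l m q).
Proof.
move=> l0 m0; have [a [b [c [d [e ->]]]]] := ptP q.
rewrite act_pt !onX_pt !mulf_eq0 (negPf l0) (negPf m0) /= => -[h1 h2 h3].
by split=> //; rewrite mulrACA h3 mulrACA.
Qed.

(** The quotient P / Q taken at q is valid at the rescaled point too, because Q is bihomogeneous and
    so nonzero there. Homogeneity, which [section] does not mention, thus follows from the bidegrees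
    of P and Q. *)
Lemma section_act L s q l m : section L s -> onX q -> l != 0 -> m != 0 ->
  s (act l m q) = l ^ (L.1 + L.2) * m ^ (- L.2) * s q.
Proof.
move=> hs hq l0 m0; have [P [Q [a [b [c [d [hP hQ [ea eb] Q0 h]]]]]]] := hs q hq.
have QE := ev_act l m q hQ.
rewrite (h q) // (h (act l m q)); last 2 first.
- exact: onX_act.
- by rewrite QE !mulf_neq0 // expf_neq0.
rewrite QE (ev_act l m q hP).
have -> : l ^+ a = l ^+ c * l ^ (L.1 + L.2).
  by rewrite -[l ^+ a]/(l ^ a%:Z) ea expfzDr.
have -> : m ^+ b = m ^+ d * m ^ (- L.2).
  by rewrite -[m ^+ b]/(m ^ b%:Z) eb expfzDr.
have lc := expf_neq0 c l0; have md := expf_neq0 d m0.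
by field; rewrite Q0 lc md.
Qed.

End Ev.

Arguments bihomogXn {k a b P} n _.

(** * Binary forms as local quotients *)

Section Univariate.
Variable k : closedFieldType.
Implicit Types (p q : {poly k}).

Lemma poly_const_root p : (exists t, root p t) \/ size p = 1%N.
Proof.
have [/eqP h|h] := boolP (size p == 1%N); [by right|by left; apply/closed_rootP].
Qed.

(** An algebraically closed field is infinite: p + 1 has no root, so it is constant, and then so is
    p. *)
Lemma poly_ext0 p : (forall t, p.[t] = 0) -> p = 0.
Proof.
move=> h; have [[t]|] := poly_const_root (p + 1).
  by rewrite rootE hornerD h hornerC add0r oner_eq0.
move=> /eqP/size_poly1P[c c0 E].
have {}E : p = (c - 1)%:P by rewrite polyCB -E; ring.
by have := h 0; rewrite E hornerC => ->.
Qed.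

Lemma poly_ext p q : (forall t, p.[t] = q.[t]) -> p = q.
Proof. by move=> h; apply/subr0_eq/poly_ext0 => t; rewrite !hornerE h subrr. Qed.

Lemma poly_ext_cofinite d p q : d != 0 ->
  (forall t, d.[t] != 0 -> p.[t] = q.[t]) -> p = q.
Proof.
move=> d0 h; apply/(mulfI d0)/poly_ext => t; rewrite !hornerM.
by have [->|dt] := eqVneq d.[t] 0; [rewrite !mul0r|rewrite h].
Qed.

Lemma poly_ext_neq0 p q : (forall t, t != 0 -> p.[t] = q.[t]) -> p = q.
Proof.
by move=> h; apply: (poly_ext_cofinite (d := 'X)); rewrite ?polyX_eq0 // => t;
  rewrite hornerX; apply: h.
Qed.

Lemma poly_roots_seq p : p != 0 ->
  {s : seq k | forall t, root p t -> t \in s}.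
Proof.
move=> p0; have [s ps] := closed_field_poly_normal p; exists s => t.
rewrite {1}ps rootZ ?lead_coef_eq0 // /root horner_prod => /eqP.
move=> /eqP; rewrite prodf_seq_eq0 => /hasP[x xs /=].
by rewrite hornerXsubC subr_eq0 => /eqP->.
Qed.

Lemma notin_seq (s : seq k) : exists t, t \notin s.
Proof.
apply: NNPP => h; have : \prod_(a <- s) ('X - a%:P) = 0.
  apply: poly_ext0 => t; have ts : t \in s by apply/negPn/negP => ts; apply: h; exists t.
  rewrite horner_prod; apply/eqP; rewrite prodf_seq_eq0; apply/hasP.
  by exists t => //=; rewrite hornerXsubC subrr.
by move/eqP; rewrite (negPf (monic_neq0 (monic_prod_XsubC _ _ _))).
Qed.

Definition regular (g : k -> k) := forall t, exists P Q : {poly k},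
  Q.[t] != 0 /\ forall t', Q.[t'] != 0 -> g t' = P.[t'] / Q.[t'].

(** Any local quotient P1 / Q1 satisfies P1 Q = P Q1, where P / Q is the reduced form of the
    quotient valid near 0. At a root of Q, coprimality makes Q divide the denominator Q1 chosen
    there, although Q1 is nonzero at that point; hence Q is constant. *)
Lemma regular_poly g : regular g -> exists p, forall t, g t = p.[t].
Proof.
move=> hg; have [P0 [Q0 [Q00 h0]]] := hg 0.
have Q0n : Q0 != 0 by apply: contraNneq Q00 => ->; rewrite horner0.
pose d := gcdp P0 Q0.
have dn : d != 0 by rewrite gcdp_eq0 negb_and Q0n orbT.
pose P := P0 %/ d; pose Q := Q0 %/ d.
have EP : P0 = P * d by rewrite /P divpK // dvdp_gcdl.
have EQ : Q0 = Q * d by rewrite /Q divpK // dvdp_gcdr.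
have cPQ : coprimep P Q by apply: coprimep_div_gcd; rewrite Q0n orbT.
have cross P1 Q1 : Q1 != 0 ->
    (forall t', Q1.[t'] != 0 -> g t' = P1.[t'] / Q1.[t']) -> P1 * Q = P * Q1.
  move=> Q1n h1; apply: (mulIf dn); rewrite -mulrA -EQ mulrAC -EP.
  apply: (poly_ext_cofinite (mulf_neq0 Q0n Q1n)) => t.
  rewrite !hornerM mulf_eq0 negb_or => /andP[a b].
  by have := h1 _ b; rewrite h0 // => /eqP; rewrite eqr_div // => /eqP->.
have [[t0 Qt0]|/eqP/size_poly1P[c c0 Qc]] := poly_const_root Q.
  have [P1 [Q1 [Q1t h1]]] := hg t0.
  have Q1n : Q1 != 0 by apply: contraNneq Q1t => ->; rewrite horner0.
  have : Q %| P * Q1 by rewrite -(cross _ _ Q1n h1) dvdp_mull.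
  rewrite Gauss_dvdpr; last by rewrite coprimep_sym.
  move=> /dvdpP[R ER]; move: Q1t; rewrite ER hornerM.
  by move/rootP: Qt0 => ->; rewrite mulr0 eqxx.
exists (c^-1 *: P) => t; have [P1 [Q1 [Q1t h1]]] := hg t.
have Q1n : Q1 != 0 by apply: contraNneq Q1t => ->; rewrite horner0.
have := congr1 (fun p => p.[t]) (cross _ _ Q1n h1).
rewrite h1 // !hornerE Qc hornerC => E.
by apply: (mulIf Q1t); rewrite divfK // -mulrA -E; field.
Qed.

Definition nz2 (a b : k) := ~~ ((a == 0) && (b == 0)).

Lemma nz2_1l t : nz2 1 t. Proof. by rewrite /nz2 oner_eq0. Qed.
Lemma nz2_1r t : nz2 t 1. Proof. by rewrite /nz2 oner_eq0 andbF. Qed.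

(* Sections of O(d) on P^1, as functions of homogeneous coordinates. *)
Record P1sec (d : int) (g : k -> k -> k) : Prop := {
  P1_hom : forall l a b : k, l != 0 -> nz2 a b -> g (l * a) (l * b) = l ^ d * g a b;
  P1_regl : regular (fun t => g 1 t);
  P1_regr : regular (fun t => g t 1) }.

(** With p and r the expressions of g in the two charts, homogeneity gives p(t) = t^d r(1/t) for
    nonzero t. Multiplication by t^m turns this into a polynomial identity between p and the
    reversal [Rv] of r, of degree at most m and with r(0) = g 0 1 as coefficient at m. Comparing
    degrees bounds p, or kills it if d < 0; comparing top coefficients gives the value at (0, 1). *)
Lemma P1sec_poly d g : P1sec d g -> exists p, [/\ forall t, g 1 t = p.[t],
  forall n : nat, d = n%:Z -> (size p <= n.+1)%N /\ g 0 1 = p`_n &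
  d < 0 -> p = 0 /\ g 0 1 = 0].
Proof.
move=> [hom /regular_poly[p hp] /regular_poly[r hr]]; exists p.
pose m := size r; pose Rv := \sum_(i < m) r`_i *: 'X^(m - i).
have sRv : (size Rv <= m.+1)%N.
  apply: (leq_trans (size_sum _ _ _)); apply/bigmax_leqP => i _.
  by apply: (leq_trans (size_scale_leq _ _)); rewrite size_polyXn ltnS leq_subr.
have RvE (t : k) : t != 0 -> Rv.[t] = t ^+ m * r.[t^-1].
  move=> t0; rewrite horner_sum [r.[_]]horner_coef mulr_sumr.
  apply: eq_bigr => i _; rewrite hornerZ hornerXn expfB_cond; last first.
    by rewrite (negPf t0) add0n ltnW.
  by rewrite exprVn; ring.
have Rvm : Rv`_m = g 0 1.
  rewrite hr horner_coef0 /Rv coef_sum; case: (posnP m) => [m0|mp].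
    by rewrite m0 big_ord0; rewrite /m in m0; rewrite nth_default ?m0.
  rewrite (bigD1 (Ordinal mp)) //= coefZ coefXn subn0 eqxx mulr1.
  rewrite big1 ?addr0 // => i /eqP i0; rewrite coefZ coefXn.
  have : i != 0%N :> nat by apply/eqP => E; apply: i0; apply: val_inj.
  have := ltn_ord i; rewrite -/m => im i1.
  by rewrite (_ : (m == m - i)%N = false) ?mulr0 //; apply/eqP; lia.
have gE (t : k) : t != 0 -> p.[t] = t ^ d * r.[t^-1].
  by move=> t0; rewrite -hp -hr -hom ?nz2_1r // mulfV // mulr1.
split=> //.
- move=> n dn; have E : 'X^m * p = 'X^n * Rv.
    apply: poly_ext_neq0 => t t0; rewrite !hornerM !hornerXn gE // RvE // dn.
    by rewrite -exprnP; ring.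
  split.
    have [->|p0] := eqVneq p 0; first by rewrite size_poly0.
    have : (size ('X^m * p)%R <= n + m.+1)%N.
      by rewrite E mulrC (leq_trans (size_polyMleq _ _)) // size_polyXn; lia.
    by rewrite mulrC size_mulXn //; lia.
  have := congr1 (fun q => q`_(n + m)) E.
  by rewrite !coefXnM !ltnNge leq_addr leq_addl /= addnK addKn Rvm => ->.
- case: d hom gE => // n hom gE _; have E : 'X^(m + n.+1) * p = Rv.
    apply: poly_ext_neq0 => t t0; rewrite !hornerM !hornerXn gE // RvE //.
    by rewrite NegzE -exprnN exprD; field; rewrite expf_neq0.
  have p0 : p = 0.
    apply/eqP; apply: contraTT sRv => p0.
    rewrite -E mulrC size_mulXn // -ltnNge.
    by have sp : (0 < size p)%N; [rewrite size_poly_gt0|lia].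
  by split=> //; rewrite -Rvm -E p0 mulr0 coef0.
Qed.

Lemma P1sec_eq0 d g : P1sec d g -> (forall t, g 1 t = 0) -> g 0 1 = 0 ->
  forall a b, nz2 a b -> g a b = 0.
Proof.
move=> [hom _ _] h1 h0 a b; have [->|a0] := eqVneq a 0.
  rewrite /nz2 eqxx /= => b0.
  by have := hom b 0 1 b0 (nz2_1r _); rewrite mulr0 mulr1 h0 mulr0.
have := hom a 1 (b / a) a0 (nz2_1l _).
by rewrite mulr1 mulrC divfK // => ->; rewrite h1 mulr0.
Qed.

Lemma P1sec_neg d g : P1sec d g -> d < 0 -> forall a b, nz2 a b -> g a b = 0.
Proof.
move=> hg d0; have [p [hp _ /(_ d0)[p0 g0]]] := P1sec_poly hg.
by apply: (P1sec_eq0 hg) => // t; rewrite hp p0 horner0.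
Qed.

Lemma P1sec_const g : P1sec 0 g -> forall a b, nz2 a b -> g a b = g 0 1.
Proof.
move=> hg; have [p [hp /(_ 0%N erefl)[sp g0] _]] := P1sec_poly hg.
have {}hp t : g 1 t = g 0 1 by rewrite hp (size1_polyC sp) hornerC g0.
case: hg => hom _ _ a b; have [->|a0] := eqVneq a 0.
  rewrite /nz2 eqxx /= => b0.
  by have := hom b 0 1 b0 (nz2_1r _); rewrite mulr0 mulr1 expr0z mul1r.
have := hom a 1 (b / a) a0 (nz2_1l _).
by rewrite mulr1 mulrC divfK // expr0z mul1r hp => ->.
Qed.

(** If p has no root it is constant, and in positive degree d its coefficient at d, which is the
    value at (0, 1), is then zero. *)
Lemma P1sec_nozero d g : P1sec d g -> (forall a b, nz2 a b -> g a b != 0) -> d = 0.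
Proof.
move=> hg nz; have [p [hp hn hN]] := P1sec_poly hg.
case: d hg hn hN => [n|n] hg hn hN; last first.
  by have [] := hN isT => _ g0; have := nz 0 1 (nz2_1r _); rewrite g0 eqxx.
have [sp g0] := hn n erefl; have [[t /rootP]|s1] := poly_const_root p.
  by rewrite -hp => E; have := nz 1 t (nz2_1l _); rewrite E eqxx.
case: n hn hg hN sp g0 => // n _ _ _ _ g0; have := nz 0 1 (nz2_1r _).
by rewrite g0 nth_default ?s1 // eqxx.
Qed.

(* The equation involving A and B says that g divides the uniformizer t at its
   only zero. *)
Lemma P1sec_simple_zero d g (A B : {poly k}) : P1sec d g -> g 0 1 != 0 ->
  (forall t, g 1 t = 0 <-> t = 0) -> A.[0] != 0 ->
  (forall t, A.[t] * t = g 1 t * B.[t]) -> d = 1.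
Proof.
move=> hg g0 gz A0 AB; have [p [hp hn hN]] := P1sec_poly hg.
case: d hg hn hN => [n|n] hg hn hN; last first.
  by have [] := hN isT => _ E; rewrite E eqxx in g0.
have [sp gn] := hn n erefl; rewrite gn in g0.
have {}sp : size p = n.+1.
  apply/eqP; rewrite eqn_leq sp /= ltnNge; apply/negP => h.
  by rewrite nth_default ?eqxx in g0.
have rt q : (forall t, root q t -> root p t) -> (1 < size q)%N -> root q 0.
  move=> h sq; have [[t qt]|] := poly_const_root q; last by lia.
  have pt := h t qt; move: pt; rewrite /root -hp => /eqP/gz E; by rewrite E in qt.
(* A nonzero constant has no zero at 0. In degree at least 2 the only root of p is 0, so X^2 divides
   p and A X = p B makes X divide A. *)
case: n sp hn gn g0 hg hN => [|[|n]] // sp hn gn g0 hg hN.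
  have : p.[0] = 0 by rewrite -hp; apply/gz.
  by rewrite horner_coef0 => E; rewrite E eqxx in g0.
have /factor_theorem[p1 E1] : root p 0 by apply: rt; rewrite ?sp.
rewrite subr0 in E1.
have p1n : p1 != 0 by apply: contra_eq_neq sp => E; rewrite E1 E mul0r size_poly0.
have s1 : size p1 = n.+2 by move: sp; rewrite E1 size_mulX // => -[].
have /factor_theorem[p2 E2] : root p1 0.
  by apply: rt; rewrite ?s1 // => t pt; rewrite E1 rootM pt.
rewrite subr0 in E2.
have : A * 'X = p * B by apply: poly_ext => t; rewrite !hornerM hornerX AB hp.
rewrite E1 E2 mulrAC => /mulIf; rewrite polyX_eq0 => /(_ isT) E.
by move: A0; rewrite E !hornerE eqxx.
Qed.

End Univariate.

(** * Closed subsets and irreducible curves *)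

Section Closed.
Variable k : closedFieldType.
Implicit Types (P Q G : {mpoly k[3 + 2]}) (q : point k) (D Y Z : subX k).

Definition same_pt q q' := exists l m : k, [/\ l != 0, m != 0 & q = act l m q'].

Lemma act_act l m l' m' q : act l m (act l' m' q) = act (l * l') (m * m') q.
Proof. by rewrite /act !scalerA. Qed.

Lemma act1 q : act 1 1 q = q.
Proof. by case: q => x u; rewrite /act !scale1r. Qed.

Lemma same_refl q : same_pt q q.
Proof. by exists 1, 1; rewrite act1 oner_neq0. Qed.

Lemma same_sym q q' : same_pt q q' -> same_pt q' q.
Proof.
move=> [l [m [l0 m0 ->]]]; exists l^-1, m^-1.
by rewrite !invr_eq0 act_act !mulVf // act1.
Qed.

Lemma same_trans q q' q'' : same_pt q q' -> same_pt q' q'' -> same_pt q q''.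
Proof.
move=> [l [m [l0 m0 ->]]] [l' [m' [l0' m0' ->]]]; exists (l * l'), (m * m').
by rewrite act_act !mulf_neq0.
Qed.

Lemma same_onX q q' : same_pt q q' -> onX q' -> onX q.
Proof. by move=> [l [m [l0 m0 ->]]]; apply: onX_act. Qed.

Lemma same_ev0 P q q' : is_bihomog P -> same_pt q q' -> ev P q' = 0 -> ev P q = 0.
Proof.
by move=> [a [b hP]] [l [m [_ _ ->]]] h; rewrite (ev_act _ _ _ hP) h mulr0.
Qed.

Lemma same_section0 L s q q' : section L s -> same_pt q q' -> onX q' ->
  (s q == 0) = (s q' == 0).
Proof.
move=> hs [l [m [l0 m0 ->]]] hq; rewrite (section_act hs hq l0 m0).
by rewrite !mulf_eq0 !expfz_eq0 (negPf l0) (negPf m0) !andbF.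
Qed.

Lemma zclosed_onX Z q : zclosed Z -> Z q -> onX q.
Proof. by move=> [S [_ h]] /h[]. Qed.

Lemma zclosed_same Z q q' : zclosed Z -> same_pt q q' -> Z q' -> Z q.
Proof.
move=> [S [hS h]] e /h[hq hq']; apply/h; split; first exact: same_onX hq.
by move=> P SP; apply: same_ev0 e _; [apply: hS|apply: hq'].
Qed.

Lemma zclosed_bihomog_pair P Q : is_bihomog P -> is_bihomog Q ->
  zclosed (fun q => [/\ onX q, ev P q = 0 & ev Q q = 0]).
Proof.
move=> hP hQ; exists (fun R => R = P \/ R = Q); split; first by move=> R [->|->].
move=> q; split => [[h1 h2 h3]|[h1 h2]]; first by split=> // R [->|->].
by split=> //; apply: h2; [left|right].
Qed.

Lemma zclosed_bihomog P : is_bihomog P ->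
  zclosed (fun q => onX q /\ ev P q = 0).
Proof.
move=> hP; exists (eq P); split; first by move=> R <-.
move=> q; split => [[h1 h2]|[h1 h2]]; first by split=> // R <-.
by split=> //; apply: h2.
Qed.

Lemma is_bihomogM P Q : is_bihomog P -> is_bihomog Q -> is_bihomog (P * Q).
Proof.
move=> [a [b hP]] [c [d hQ]]; exists (a + c)%N, (b + d)%N; exact: bihomogM.
Qed.

Lemma zclosedU Y Z : zclosed Y -> zclosed Z -> zclosed (fun q => Y q \/ Z q).
Proof.
move=> [S [hS hY]] [T [hT hZ]].
exists (fun R => exists P Q, [/\ S P, T Q & R = P * Q]); split.
  by move=> R [P [Q [/hS SP /hT TQ ->]]]; apply: is_bihomogM.
move=> q; split.
- move=> [/hY|/hZ] [hq h]; split=> // R [P [Q [SP TQ ->]]]; rewrite evM.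
    by rewrite (h _ SP) mul0r.
  by rewrite (h _ TQ) mulr0.
- move=> [hq h]; apply: NNPP => /not_or_and[nY nZ].
  have [P [SP P0]] : exists P, S P /\ ev P q != 0.
    apply: NNPP => nP; apply: nY; apply/hY; split=> // P SP.
    by apply/eqP/negPn/negP => P0; apply: nP; exists P.
  have [Q [TQ Q0]] : exists Q, T Q /\ ev Q q != 0.
    apply: NNPP => nP; apply: nZ; apply/hZ; split=> // R SR.
    by apply/eqP/negPn/negP => R0; apply: nP; exists R.
  have : ev (P * Q) q = 0 by apply: h; exists P, Q.
  by rewrite evM => /eqP; rewrite mulf_eq0 (negPf P0) (negPf Q0).
Qed.

Lemma zclosed0 : zclosed (fun _ : point k => False).
Proof.
exists (eq 1); split; first by move=> P <-; exists 0%N, 0%N; apply: bihomog1.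
move=> q; split=> // -[_ /(_ _ erefl)]; rewrite ev1 => /eqP.
by rewrite oner_eq0.
Qed.

Lemma zclosed_ext Y Z : (forall q, Y q <-> Z q) -> zclosed Y -> zclosed Z.
Proof.
by move=> e [S [h1 h2]]; exists S; split=> // q; rewrite -e; apply: h2.
Qed.

(* A point is cut out by the 2x2 minors of its coordinate vectors with the
   indeterminates. *)
Lemma zclosed_pt q0 : onX q0 -> zclosed (fun q => same_pt q q0).
Proof.
move=> h0; exists (fun P => is_bihomog P /\ ev P q0 = 0); split; first by move=> P [].
move=> q; split.
  by move=> e; split=> [|P [hP P0]]; [apply: same_onX h0|apply: same_ev0 P0].
move=> [[x0 u0 _] h]; case: h0 => x00 u00 _.
have prop n (v v0 : 'rV[k]_n) : v != 0 -> v0 != 0 ->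
    (forall i j, v 0 i * v0 0 j = v 0 j * v0 0 i) ->
    exists2 l, l != 0 & v = l *: v0.
  move=> vn vn0 E; have [j vj] : exists j, v0 0 j != 0.
    apply: NNPP => n0; case/eqP: vn0; apply/rowP => j; rewrite mxE.
    by apply/eqP/negPn/negP => vj; apply: n0; exists j.
  have Ev : v = (v 0 j / v0 0 j) *: v0.
    by apply/rowP => i; rewrite mxE mulrAC -E mulfK.
  exists (v 0 j / v0 0 j) => //; apply: contraNneq vn => l0.
  by rewrite Ev l0 scale0r.
have [l l0 El] : exists2 l, l != 0 & q.1 = l *: q0.1.
  apply: prop => // i j.
  pose P : {mpoly k[3 + 2]} := q0.1 0 j *: 'X_(lshift 2 i) - q0.1 0 i *: 'X_(lshift 2 j).
  have PE q' : ev P q' = q0.1 0 j * q'.1 0 i - q0.1 0 i * q'.1 0 j.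
    by rewrite /P !evE /ev !mevalXU !row_mxEl.
  have : ev P q = 0.
    apply: h; split; last by rewrite PE; ring.
    by exists 1%N, 0%N; apply: bihomogB; apply: bihomogZ; apply: bihomogx.
  by rewrite PE => /subr0_eq E; rewrite mulrC E mulrC.
have [m m0 Em] : exists2 l, l != 0 & q.2 = l *: q0.2.
  apply: prop => // i j.
  pose P : {mpoly k[3 + 2]} := q0.2 0 j *: 'X_(rshift 3 i) - q0.2 0 i *: 'X_(rshift 3 j).
  have PE q' : ev P q' = q0.2 0 j * q'.2 0 i - q0.2 0 i * q'.2 0 j.
    by rewrite /P !evE /ev !mevalXU !row_mxEr.
  have : ev P q = 0.
    apply: h; split; last by rewrite PE; ring.
    by exists 0%N, 1%N; apply: bihomogB; apply: bihomogZ; apply: bihomogu.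
  by rewrite PE => /subr0_eq E; rewrite mulrC E mulrC.
exists l, m; split=> //; rewrite /act -El -Em.
by case: (q).
Qed.

Lemma zirreducible_pt q0 : onX q0 -> zirreducible (fun q => same_pt q q0).
Proof.
move=> h0; split; [exact: zclosed_pt|by exists q0; apply: same_refl|].
move=> Y1 Y2 c1 c2 h; have [Yq|Yq] := h _ (same_refl q0); [left|right];
  by move=> q e; apply: zclosed_same e Yq.
Qed.

(** * Finite sets of points and a criterion for irreducible curves *)

Definition zfinite Z :=
  exists l : seq (point k), forall q, Z q -> exists2 q', q' \in l & same_pt q q'.

Definition zinfinite Z := forall l : seq (point k),
  exists2 q, Z q & forall q', q' \in l -> ~ same_pt q q'.

Lemma zinfiniteN Z : zfinite Z -> zinfinite Z -> False.
Proof. by move=> [l h] /(_ l)[q /h[q' ql e] /(_ q' ql)]. Qed.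

Lemma zfiniteU Y Z : zfinite Y -> zfinite Z -> zfinite (fun q => Y q \/ Z q).
Proof.
move=> [l h] [l' h']; exists (l ++ l') => q [/h|/h'] [q' ql e]; exists q' => //;
  by rewrite mem_cat ql ?orbT.
Qed.

Lemma zfinite_sub Y Z : incl Y Z -> zfinite Z -> zfinite Y.
Proof. by move=> h [l hl]; exists l => q /h/hl. Qed.

Lemma zinfinite_ratio (r : point k -> k) Z :
  (forall l m q, l != 0 -> m != 0 -> r (act l m q) = r q) ->
  (forall t, exists2 q, Z q & r q = t) -> zinfinite Z.
Proof.
move=> inv h l; have [t tl] := notin_seq (map r l); have [q Zq rq] := h t.
exists q => // q' ql [a [b [a0 b0 E]]]; case/negP: tl.
by rewrite -rq E inv //; apply: map_f.
Qed.

(** Induction on the list: its head is a closed point and its tail lists a closed set, so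
    irreducibility places Y in one of the two. Entries outside X represent no point of Y and are
    dropped. *)
Lemma zirreducible_finite Y : zirreducible Y -> zfinite Y ->
  exists2 q0, Y q0 & incl Y (fun q => same_pt q q0).
Proof.
move=> [cY [q1 Yq1] irr] [l].
have {}irr : forall l : seq (point k), (forall q, Y q -> exists2 q', q' \in l & same_pt q q') ->
    exists2 q0, onX q0 & incl Y (fun q => same_pt q q0).
  move=> {}l; elim: l => [|q0 l IH] h; first by have [] := h _ Yq1.
  have [hq0|nq0] := classic (onX q0); last first.
    apply: IH => q Yq; have [q'] := h q Yq; rewrite inE => /orP[/eqP->|ql] e.
      by case: nq0; apply: same_onX (same_sym e) (zclosed_onX cY Yq).
    by exists q'.
  have cZ : zclosed (fun q => onX q /\ exists2 q', q' \in l & same_pt q q').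
    elim: {h IH} l => [|q' l IH]; first by apply: zclosed_ext zclosed0 => q; split=> // -[_ []].
    have [hq'|nq'] := classic (onX q').
      apply: zclosed_ext (zclosedU (zclosed_pt hq') IH) => q; split.
        move=> [e|[hq [q'' ql e]]]; split=> //; [exact: same_onX hq'| |].
          by exists q'; rewrite ?mem_head.
        by exists q''; rewrite // inE ql orbT.
      move=> [hq [q'']]; rewrite inE => /orP[/eqP->|ql] e; first by left.
      by right; split=> //; exists q''.
    apply: zclosed_ext IH => q; split=> -[hq [q'' ql e]]; split=> //; exists q'' => //.
      by rewrite inE ql orbT.
    move: ql; rewrite inE => /orP[/eqP E|//]; case: nq'; rewrite -E.
    exact: same_onX (same_sym e) hq.
  have [|h1|h1] := irr _ _ (zclosed_pt hq0) cZ.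
  - move=> q Yq; have [q'] := h q Yq; rewrite inE => /orP[/eqP->|ql] e; first by left.
    by right; split; [apply: zclosed_onX Yq|exists q'].
  - by exists q0.
  - by apply: IH => q /h1[].
move=> /irr[q0 hq0 h]; exists q1 => // q Yq.
by apply: same_trans (h q Yq) (same_sym (h q1 Yq1)).
Qed.

(** Every closed set that does not contain D meets it in finitely many points. Irreducibility
    follows because D is infinite; dimension one follows because an irreducible finite set is a
    single point, which has no smaller nonempty closed subset. *)
Lemma irreducible_curve_crit D : zclosed D -> zinfinite D ->
  (forall G, is_bihomog G -> (forall q, D q -> ev G q = 0) \/
     zfinite (fun q => D q /\ ev G q = 0)) ->
  irreducible_curve D.
Proof.
move=> cD infD dich.
have cut Y : zclosed Y -> ~ incl D Y -> zfinite (fun q => D q /\ Y q).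
  move=> [S [hS hY]] nD; apply: NNPP => nf; apply: nD => q Dq; apply/hY.
  split=> [|P SP]; first exact: zclosed_onX Dq.
  have [h|h] := dich P (hS _ SP); first exact: h.
  case: nf; apply: zfinite_sub h => q' [Dq' /hY[_ h]]; split=> //; exact: h.
split.
- split=> //; first by have [q Dq _] := infD [::]; exists q.
  move=> Y1 Y2 c1 c2 h; apply: NNPP => /not_or_and[/(cut _ c1) f1 /(cut _ c2) f2].
  apply: zinfiniteN infD; apply: zfinite_sub (zfiniteU f1 f2) => q Dq.
  by have [] := h q Dq; [left|right].
- have [q0 Dq0 _] := infD [::]; exists (fun q => same_pt q q0); split.
    exact: zirreducible_pt (zclosed_onX cD Dq0).
  split=> [q e|h]; first exact: zclosed_same e Dq0.
  apply: (zinfiniteN _ infD); exists [:: q0] => q /h e.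
  by exists q0; rewrite ?mem_head.
- move=> [Y1 [Y2 [[c1 [q1 Yq1] _] irr2 [s1 n1] [s2 n2]]]].
  have c2 : zclosed Y2 by case: irr2.
  have f2 : zfinite Y2.
    by apply: zfinite_sub (cut _ c2 n2) => q Yq; split=> //; apply: s2.
  have [q0 _ h] := zirreducible_finite irr2 f2.
  apply: n1 => q Yq; apply: (zclosed_same c1 _ Yq1).
  exact: same_trans (h q Yq) (same_sym (h q1 (s1 _ Yq1))).
Qed.

(** Otherwise a point set below C, then C, then D would form a chain too long for a curve. *)
Lemma irreducible_curve_incl C D : irreducible_curve C -> irreducible_curve D ->
  incl C D -> incl D C.
Proof.
move=> [irrC [Y [irrY YC]] _] [_ _ nD] CD; apply: NNPP => DC.
by apply: nD; exists Y, C.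
Qed.

End Closed.

(** * Rational curves on X *)

Section Rational.
Variable k : closedFieldType.
Implicit Types (P Q G : {mpoly k[3 + 2]}) (q : point k) (D Y Z : subX k).

Definition poly_path (x : k -> point k) := exists a b c d e : {poly k},
  forall t, x t = pt a.[t] b.[t] c.[t] d.[t] e.[t].

Lemma poly_path_ev x P : poly_path x -> exists p : {poly k}, forall t, ev P (x t) = p.[t].
Proof.
move=> [a [b [c [d [e h]]]]]; exists (pull (@polyC k) a b c d e P) => t.
by rewrite h -[RHS]/(horner_eval t _) pullP // => y; rewrite /= horner_evalE hornerC.
Qed.

(* A map from P^1 to X of degrees a and b over P^2 and P^1. *)
Record param (g : k -> k -> point k) (a b : nat) : Prop := {
  param_onX : forall v w, nz2 v w -> onX (g v w);
  param_act : forall l v w, g (l * v) (l * w) = act (l ^+ a) (l ^+ b) (g v w);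
  param_l : poly_path (fun t => g 1 t);
  param_r : poly_path (fun t => g t 1) }.

Lemma param_bihomog g a b P c d : param g a b -> bihomog c d P ->
  P1sec (a * c + b * d)%:Z (fun v w => ev P (g v w)).
Proof.
move=> hg hP; split.
- move=> l v w l0 _; rewrite (param_act hg) (ev_act _ _ _ hP).
  by rewrite -!exprM -exprD.
- have [p hp] := poly_path_ev P (param_l hg) => t; exists p, 1.
  by rewrite hornerC oner_neq0; split=> // t' _; rewrite hp hornerC divr1.
- have [p hp] := poly_path_ev P (param_r hg) => t; exists p, 1.
  by rewrite hornerC oner_neq0; split=> // t' _; rewrite hp hornerC divr1.
Qed.

Lemma section_regular L (s : point k -> k) x : section L s -> poly_path x ->
  (forall t, onX (x t)) -> regular (fun t => s (x t)).
Proof.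
move=> hs px hx t; have [P [Q [a [b [c [d [_ _ _ Q0 h]]]]]]] := hs _ (hx t).
have [p hp] := poly_path_ev P px; have [q hq] := poly_path_ev Q px.
exists p, q; rewrite -hq; split=> // t' qt'; rewrite -hp -hq; apply: h => //.
by rewrite hq.
Qed.

(** The substitute for intersection numbers: the degree is that of the pullback of O(L.1 + L.2, -
    L.2) under a map of bidegree (a, b). *)
Lemma param_section g a b (L : cls) s : param g a b -> section L s ->
  P1sec (a%:Z * (L.1 + L.2) + b%:Z * (- L.2)) (fun v w => s (g v w)).
Proof.
move=> hg hs; split.
- move=> l v w l0 hv; rewrite (param_act hg).
  rewrite (section_act hs (param_onX hg hv)) ?expf_neq0 //.
  rewrite -[l ^+ a]/(l ^ a%:Z) -[l ^+ b]/(l ^ b%:Z) !exprz_exp -expfzDr //.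
- by apply: section_regular hs (param_l hg) _ => t; apply: (param_onX hg); apply: nz2_1l.
- by apply: section_regular hs (param_r hg) _ => t; apply: (param_onX hg); apply: nz2_1r.
Qed.

(** A bihomogeneous G pulls back to a binary form on P^1, which is zero or has finitely many roots;
    [g 0 1] is the one point outside the chart v = 1. *)
Lemma param_irreducible g a b D : param g a b -> zclosed D -> zinfinite D ->
  (forall v w, nz2 v w -> D (g v w)) ->
  (forall q, D q -> exists v w, nz2 v w /\ same_pt q (g v w)) ->
  irreducible_curve D.
Proof.
move=> hg cD iD Dg gD; apply: irreducible_curve_crit => // G hG.
have [c [d hcd]] := hG; have hs := param_bihomog hg hcd.
have [p hp] := poly_path_ev G (param_l hg).
have [p0|p0] := eqVneq p 0.
  left=> q /gD[v [w [hv e]]]; apply: same_ev0 e _ => //.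
  have [p' [hp' /(_ _ erefl)[_ e1] _]] := P1sec_poly hs.
  have E : p' = 0 by apply: poly_ext0 => t; rewrite -hp' hp p0 horner0.
  apply: (P1sec_eq0 hs) hv; first by move=> t; rewrite hp p0 horner0.
  by rewrite e1 E coef0.
right; have [s hps] := poly_roots_seq p0.
exists (g 0 1 :: map (g 1) s) => q [/gD[v [w [hv e]]] Gq].
have [v0|v0] := eqVneq v 0.
  exists (g 0 1); first exact: mem_head.
  apply: same_trans e _; exists (w ^+ a), (w ^+ b).
  have w0 : w != 0 by move: hv; rewrite /nz2 v0 eqxx.
  by rewrite !expf_neq0 // -(param_act hg) mulr0 mulr1 v0.
have e' : same_pt q (g 1 (w / v)).
  apply: same_trans e _; exists (v ^+ a), (v ^+ b).
  by rewrite !expf_neq0 // -(param_act hg) mulr1 mulrC divfK.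
exists (g 1 (w / v)) => //; rewrite inE map_f ?orbT // hps //.
by rewrite rootE -hp; apply/eqP/(same_ev0 hG (same_sym e')).
Qed.

(** The exceptional curve in coordinates with respect to a basis v, v' of k^2, so that the point of
    [E] on a prescribed fibre can be put at (1, 0). *)
Definition Eparam (v0 v1 v0' v1' a b : k) :=
  pt 0 0 1 (a * v0 + b * v0') (a * v1 + b * v1').
Definition Fparam (v0 v1 z e : k) := cox v0 v1 e z.
Definition Lparam (u0 u1 : k) := pt u0 u1 0 u0 u1.

Lemma poly_path_affine (a b c d e a' b' c' d' e' : k) (x : k -> point k) :
  (forall t, x t = pt (a + t * a') (b + t * b') (c + t * c') (d + t * d') (e + t * e')) ->
  poly_path x.
Proof.
move=> h; exists (a%:P + a' *: 'X), (b%:P + b' *: 'X), (c%:P + c' *: 'X),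
  (d%:P + d' *: 'X), (e%:P + e' *: 'X) => t.
by rewrite !hornerE h; congr pt; ring.
Qed.

Lemma Eparam_param v0 v1 v0' v1' : v0 * v1' - v1 * v0' != 0 ->
  param (Eparam v0 v1 v0' v1') 0 1.
Proof.
move=> dn; split.
- move=> v w hv; rewrite /Eparam onX_pt oner_eq0 !andbF; split=> //; last by ring.
  apply: contra hv => /andP[/eqP e1 /eqP e2].
  have : (v0 * v1' - v1 * v0') * v = 0.
    have -> : (v0 * v1' - v1 * v0') * v = v1' * (v * v0 + w * v0') - v0' * (v * v1 + w * v1') by ring.
    by rewrite e1 e2; ring.
  have : (v0 * v1' - v1 * v0') * w = 0.
    have -> : (v0 * v1' - v1 * v0') * w = v0 * (v * v1 + w * v1') - v1 * (v * v0 + w * v0') by ring.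
    by rewrite e1 e2; ring.
  by move/eqP; rewrite mulf_eq0 (negPf dn) /= => -> /eqP; rewrite mulf_eq0 (negPf dn) /= => ->.
- by move=> l v w; rewrite /Eparam act_pt expr0 expr1; congr pt; ring.
- apply: (@poly_path_affine 0 0 1 v0 v1 0 0 0 v0' v1') => t; rewrite /Eparam; congr pt; ring.
- apply: (@poly_path_affine 0 0 1 v0' v1' 0 0 0 v0 v1) => t; rewrite /Eparam; congr pt; ring.
Qed.

Lemma Fparam_param v0 v1 : nz2 v0 v1 -> param (Fparam v0 v1) 1 0.
Proof.
move=> hv; split.
- by move=> v w hw; apply/onX_cox; split=> //; rewrite andbC.
- by move=> l v w; rewrite /Fparam /cox act_pt expr0 expr1; congr pt; ring.
- apply: (@poly_path_affine 0 0 1 v0 v1 v0 v1 0 0 0) => t; rewrite /Fparam /cox; congr pt; ring.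
- apply: (@poly_path_affine v0 v1 0 v0 v1 0 0 1 0 0) => t; rewrite /Fparam /cox; congr pt; ring.
Qed.

Lemma Lparam_param : param Lparam 1 1.
Proof.
split.
- move=> v w; rewrite /nz2 /Lparam onX_pt eqxx andbT => hv; split=> //; ring.
- by move=> l v w; rewrite /Lparam act_pt !expr1 mulr0.
- apply: (@poly_path_affine 1 0 0 1 0 0 1 0 0 1) => t; rewrite /Lparam; congr pt; ring.
- apply: (@poly_path_affine 0 1 0 0 1 1 0 0 1 0) => t; rewrite /Lparam; congr pt; ring.
Qed.

(** * The exceptional curve and the fibres as closed sets, and their classes *)

Definition Ecurve : subX k :=
  fun q => [/\ onX q, ev 'X_ix0 q = 0 & ev 'X_ix1 q = 0].

Definition Fform (v0 v1 : k) : {mpoly k[3 + 2]} := v0 *: 'X_iu1 - v1 *: 'X_iu0.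
Definition Fcurve (v0 v1 : k) : subX k := fun q => onX q /\ ev (Fform v0 v1) q = 0.

Lemma Fform_bihomog v0 v1 : bihomog 0 1 (Fform v0 v1).
Proof. by apply: bihomogB; apply: bihomogZ; apply: bihomogu. Qed.

Lemma Fform_cox v0 v1 u0 u1 e z : ev (Fform v0 v1) (cox u0 u1 e z) = v0 * u1 - v1 * u0.
Proof. by rewrite /Fform /cox !evE. Qed.

Lemma Ecurve_cox u0 u1 e z : onX (cox u0 u1 e z) -> Ecurve (cox u0 u1 e z) <-> e = 0.
Proof.
move=> hq; rewrite /Ecurve /cox !evX !row5E; split; last by move=> e0; split=> //; rewrite e0 mul0r.
move/onX_cox: hq => [hu _] [_ /eqP a0 /eqP b0]; apply/eqP; apply: contraNT hu => e0.
by move: a0 b0; rewrite !mulf_eq0 (negPf e0) /= => -> ->.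
Qed.

Lemma Ecurve_param v0 v1 v0' v1' q : v0 * v1' - v1 * v0' != 0 ->
  Ecurve q <-> exists v w, nz2 v w /\ same_pt q (Eparam v0 v1 v0' v1' v w).
Proof.
move=> dn; split.
  move=> Eq; have [hq _ _] := Eq; have [u0 [u1 [e [z [Q hu hz]]]]] := onX_coxP hq.
  move: Eq; rewrite Q Ecurve_cox -?Q // => e0; rewrite Q e0 in hz *.
  rewrite eqxx /= in hz; pose dd := v0 * v1' - v1 * v0'.
  (* Cramer's rule for u in the basis v, v'. *)
  exists ((u0 * v1' - u1 * v0') / dd), ((v0 * u1 - v1 * u0) / dd).
  have E0 : (u0 * v1' - u1 * v0') / dd * v0 + (v0 * u1 - v1 * u0) / dd * v0' = u0.
    by rewrite /dd; field.
  have E1 : (u0 * v1' - u1 * v0') / dd * v1 + (v0 * u1 - v1 * u0) / dd * v1' = u1.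
    by rewrite /dd; field.
  split.
    apply: contra hu => /andP[/eqP a0 /eqP b0]; move: E0 E1.
    by rewrite a0 b0 !mul0r !addr0 => <- <-; rewrite eqxx.
  exists z, 1; rewrite oner_neq0 /Eparam act_pt E0 E1 /cox; split=> //.
  by congr pt; ring.
move=> [v [w [hv e]]]; have hX := param_onX (Eparam_param dn) hv.
split; first exact: same_onX hX.
  apply: same_ev0 e _; last by rewrite /Eparam evX !row5E.
  by exists 1%N, 0%N; apply: bihomogx.
apply: same_ev0 e _; last by rewrite /Eparam evX !row5E.
by exists 1%N, 0%N; apply: bihomogx.
Qed.

Lemma Fcurve_param v0 v1 q : nz2 v0 v1 ->
  Fcurve v0 v1 q <-> exists v w, nz2 v w /\ same_pt q (Fparam v0 v1 v w).
Proof.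
move=> hv; split; last first.
  move=> [a [b [hab e]]]; split; first exact: same_onX e (param_onX (Fparam_param hv) hab).
  apply: same_ev0 e _; first by exists 0%N, 1%N; apply: Fform_bihomog.
  by rewrite Fform_cox; ring.
move=> [hq]; have [u0 [u1 [e [z [-> hu hz]]]]] := onX_coxP hq.
rewrite Fform_cox => /subr0_eq E.
have [m m0 [-> ->]] : exists2 m, m != 0 & u0 = m * v0 /\ u1 = m * v1.
  have [v00|v00] := eqVneq v0 0.
    have v10 : v1 != 0 by move: hv; rewrite /nz2 v00 eqxx.
    have u00 : u0 = 0.
      by apply/eqP; move/eqP: E; rewrite v00 mul0r eq_sym mulf_eq0 (negPf v10).
    exists (u1 / v1); last by rewrite u00 v00 mulr0 divfK.
    by rewrite mulf_neq0 ?invr_eq0 //; move: hu; rewrite u00 eqxx.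
  have E1 : u1 = u0 / v0 * v1 by rewrite mulrAC [u0 * v1]mulrC -E mulrC mulKf.
  exists (u0 / v0); last by rewrite divfK.
  rewrite mulf_neq0 ?invr_eq0 //; apply: contra hu => /eqP u00.
  by rewrite E1 u00 !mul0r eqxx.
exists z, (e * m); split.
  by rewrite /nz2 mulf_eq0 (negPf m0) orbF andbC.
by exists 1, m; rewrite oner_neq0 /Fparam /cox act_pt; split=> //; congr pt; ring.
Qed.

Lemma Ecurve_irreducible : irreducible_curve Ecurve.
Proof.
have dn : (1 : k) * 1 - 0 * 0 != 0 by rewrite !(mulr0, mulr1, subr0) oner_neq0.
apply: (param_irreducible (Eparam_param dn)).
- by apply: zclosed_bihomog_pair; exists 1%N, 0%N; apply: bihomogx.
- apply: (@zinfinite_ratio _ (fun q => ev 'X_iu1 q / ev 'X_iu0 q)).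
    move=> l m q l0 m0; rewrite !(ev_act _ _ _ (@bihomogu k _)) expr0 expr1 !mul1r.
    by rewrite -mulf_div divff // mul1r.
  move=> t; exists (cox 1 t 0 1); last by rewrite /cox !evE divr1.
  have hX : onX (cox 1 t 0 1) by rewrite onX_cox oner_eq0 !andbF.
  exact/Ecurve_cox.
- by move=> v w hv; apply/(Ecurve_param _ dn); exists v, w; split=> //; apply: same_refl.
- by move=> q /(Ecurve_param _ dn).
Qed.

Lemma Fcurve_irreducible v0 v1 : nz2 v0 v1 -> irreducible_curve (Fcurve v0 v1).
Proof.
move=> hv; apply: (param_irreducible (Fparam_param hv)).
- by apply: zclosed_bihomog; exists 0%N, 1%N; apply: Fform_bihomog.
- pose r q : k := if v0 == 0 then ev 'X_ix2 q / ev 'X_ix1 q else ev 'X_ix2 q / ev 'X_ix0 q.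
  apply: (@zinfinite_ratio _ r).
    move=> l m q l0 m0; rewrite /r !(ev_act _ _ _ (@bihomogx k _)) expr0 expr1 !mulr1.
    by case: ifP => _; rewrite -mulf_div divff // mul1r.
  move=> t; exists (cox v0 v1 1 (t * (if v0 == 0 then v1 else v0))).
    split; first by rewrite onX_cox oner_eq0.
    by rewrite Fform_cox; ring.
  rewrite /r /cox !evE !mul1r; case: eqVneq => [v00|v00]; rewrite mulfK //.
  by move: hv; rewrite /nz2 v00 eqxx.
- by move=> v w hw; apply/(Fcurve_param _ hv); exists v, w; split=> //; apply: same_refl.
- by move=> q /(Fcurve_param _ hv).
Qed.

(* Cox coordinate e as a function: x0 = e u0 and x1 = e u1. *)
Definition esec (q : point k) : k :=
  if ev 'X_iu0 q == 0 then ev 'X_ix1 q / ev 'X_iu1 q else ev 'X_ix0 q / ev 'X_iu0 q.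

Lemma esec_cox u0 u1 e z : ~~ ((u0 == 0) && (u1 == 0)) -> esec (cox u0 u1 e z) = e.
Proof.
move=> hu; rewrite /esec /cox !evE; case: eqVneq => u00; rewrite mulfK //.
by move: hu; rewrite u00 eqxx.
Qed.

Lemma esec_section : section E esec.
Proof.
move=> q hq; have [u0 [u1 [e [z [Q hu hz]]]]] := onX_coxP hq.
have [u00|u00] := eqVneq u0 0.
  exists 'X_ix1, 'X_iu1, 1%N, 0%N, 0%N, 1%N; split.
  - exact: bihomogx.
  - exact: bihomogu.
  - by [].
  - by rewrite Q /cox !evE; move: hu; rewrite u00 eqxx.
  - move=> q' hq'; have [u0' [u1' [e' [z' [-> hu' _]]]]] := onX_coxP hq'.
    by rewrite esec_cox // /cox !evE => u10; rewrite mulfK.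
exists 'X_ix0, 'X_iu0, 1%N, 0%N, 0%N, 1%N; split.
- exact: bihomogx.
- exact: bihomogu.
- by [].
- by rewrite Q /cox !evE.
- move=> q' hq'; have [u0' [u1' [e' [z' [-> hu' _]]]]] := onX_coxP hq'.
  by rewrite esec_cox // /cox !evE => u10; rewrite mulfK.
Qed.

(** Off [E] some x_j = e u_j is a unit, and x_j G = e (u_j G). Near [E], write G = x0 B0 + x1 B1 +
    G0 with G0 free of x0 and x1: since G0 does not depend on e, it vanishes because G does on [E],
    and e (u0 B0 + u1 B1) remains. *)
Lemma Ecurve_class : has_class Ecurve E.
Proof.
exists esec; split; first exact: esec_section.
  move=> q Eq; have [hq _ _] := Eq; have [u0 [u1 [e [z [Q hu hz]]]]] := onX_coxP hq.
  by move: Eq; rewrite Q Ecurve_cox -?Q // => e0; rewrite Q esec_cox.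
move=> G [a [b hG]] G0 q hq.
have [u0 [u1 [e [z [Q hu hz]]]]] := onX_coxP hq.
have [e0|e0] := eqVneq e 0; last first.
  have [j uj xj] : exists2 j, ev 'X_(lshift 2 j) q != 0 &
     forall q', onX q' -> ev 'X_(lshift 2 j) q' = esec q' * ev 'X_(if j == inord 0 then iu0 else iu1) q'.
    have [u00|u00] := eqVneq u0 0.
      exists (inord 1).
        rewrite Q /cox !evE mulf_neq0 //; by move: hu; rewrite u00 eqxx.
      move=> q' hq'; have [u0' [u1' [e' [z' [-> hu' _]]]]] := onX_coxP hq'.
      rewrite esec_cox // ifN; last by rewrite -val_eqE /= !inordK.
      by rewrite /cox !evE.
    exists (inord 0); first by rewrite Q /cox !evE mulf_neq0.
    move=> q' hq'; have [u0' [u1' [e' [z' [-> hu' _]]]]] := onX_coxP hq'.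
    by rewrite esec_cox // eqxx /cox !evE.
  exists 'X_(lshift 2 j), ('X_(if j == inord 0 then iu0 else iu1) * G); split=> //.
  - by exists 1%N, 0%N; apply: bihomogx.
  - apply: is_bihomogM; last by exists a, b.
    by exists 0%N, 1%N; case: ifP => _; apply: bihomogu.
  - by move=> q' hq'; rewrite xj // evM mulrA.
have [B0 [B1 [G0' [EG hB0 hB1 hG0 indep]]]] := split_two_vars ix0 ix1 hG.
(* Setting e to 0 stays in X only if z is nonzero; the factor z, a unit on [E], settles the points
   with z = 0. *)
exists 'X_ix2, ('X_ix2 * ('X_iu0 * B0 + 'X_iu1 * B1)); split.
- by exists 1%N, 0%N; apply: bihomogx.
- apply: is_bihomogM; first by exists 1%N, 0%N; apply: bihomogx.
  eexists; eexists; apply: bihomogD (hB0 iu0) _.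
  by have := hB1 iu1; rewrite /= !inordK.
- by rewrite Q /cox !evE; move: hz; rewrite e0 eqxx.
move=> q' hq'; have [u0' [u1' [e' [z' [-> hu' hz']]]]] := onX_coxP hq'.
rewrite esec_cox // EG /cox !evE.
suff : z' * ev G0' (cox u0' u1' e' z') = 0 by rewrite /cox => E; rewrite !mulrDr E; ring.
have [->|z0] := eqVneq z' 0; first by rewrite mul0r.
have <- : ev G0' (cox u0' u1' 0 z') = ev G0' (cox u0' u1' e' z').
  apply: indep => i; rewrite /cox /pt /= -/(row5 _ _ _ _ _).
  case: (split_ordP i) => j -> h0 h1; rewrite ?row_mxEr // !row_mxEl !mxE.
  have {}h0 : j != 0 :> nat by apply: contraNneq h0 => E; apply/eqP/val_inj; rewrite /= inordK.
  have {}h1 : j != 1%N :> nat by apply: contraNneq h1 => E; apply/eqP/val_inj; rewrite /= inordK.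
  by rewrite (negPf h0) (negPf h1).
have hE : Ecurve (cox u0' u1' 0 z').
  by apply/Ecurve_cox => //; rewrite onX_cox eqxx.
have := G0 _ hE; rewrite EG /cox !evE !mul0r !add0r => ->.
by rewrite mulr0.
Qed.

(* u1 is a unit near the fibre u0 = 0. *)
Lemma fibre_div G a b : bihomog a b G ->
  (forall q, onX q -> ev 'X_iu0 q = 0 -> ev G q = 0) ->
  exists B, bihomog a b B /\
    forall q, onX q -> ev 'X_iu1 q * ev G q = ev 'X_iu0 q * ev B q.
Proof.
move=> hG G0.
have [B0 [B1 [G0' [EG hB0 hB1 hG0 indep]]]] := split_two_vars iu0 ix0 hG.
exists ('X_iu1 * B0 + 'X_ix1 * B1); split.
  apply: bihomogD.
    by apply: bihomog_eq (hB0 iu1) _ _ => /=; rewrite ?inordK //=; lia.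
  by apply: bihomog_eq (hB1 ix1) _ _ => /=; rewrite ?inordK //=; lia.
move=> q hq; have [u0 [u1 [e [z [-> hu hz]]]]] := onX_coxP hq.
rewrite EG /cox !evE.
suff : u1 * ev G0' (cox u0 u1 e z) = 0 by rewrite /cox => E; rewrite !mulrDr E; ring.
have [->|u10] := eqVneq u1 0; first by rewrite mul0r.
have <- : ev G0' (cox 0 u1 e z) = ev G0' (cox u0 u1 e z).
  apply: indep => i; rewrite /cox /pt /= -/(row5 _ _ _ _ _).
  case: (split_ordP i) => j -> h0 h1; rewrite ?row_mxEr ?row_mxEl !mxE.
    have {}h1 : j != 0 :> nat by apply: contraNneq h1 => E; apply/eqP/val_inj; rewrite /= inordK.
    by rewrite (negPf h1).
  have {}h0 : j != 0 :> nat.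
    by apply: contraNneq h0 => E; apply/eqP/val_inj; rewrite /= inordK // E.
  by rewrite (negPf h0).
have hX : onX (cox 0 u1 e z) by rewrite onX_cox (negPf u10) andbF.
have := G0 _ hX; rewrite EG /cox !evE => /(_ erefl).
by rewrite mulr0 !mul0r !add0r => ->; rewrite mulr0.
Qed.

Lemma Fcurve_class : has_class (Fcurve 0 1) f.
Proof.
have FE q : ev (Fform 0 1) q = - ev 'X_iu0 q by rewrite /Fform !evE; ring.
exists (ev (Fform 0 1)); split.
- exact: (@sectionE _ f 0 1 _ (@Fform_bihomog 0 1)).
- by move=> q [].
move=> G [a [b hG]] G0 q hq.
have [u0|u0] := eqVneq (ev (Fform 0 1) q) 0; last first.
  exists (Fform 0 1), G; split=> //; [|by exists a, b].
  by exists 0%N, 1%N; apply: Fform_bihomog.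
have [B [hB EB]] : exists B, bihomog a b B /\
    forall q, onX q -> ev 'X_iu1 q * ev G q = ev 'X_iu0 q * ev B q.
  by apply: fibre_div => // q' hq' u0'; apply: G0; split=> //; rewrite FE u0' oppr0.
exists 'X_iu1, (- B); split.
- by exists 0%N, 1%N; apply: bihomogu.
- by exists a, b; apply: bihomogN.
- move: u0; rewrite FE => /eqP; rewrite oppr_eq0.
  have [u0' [u1' [e' [z' [-> hu' hz']]]]] := onX_coxP hq.
  by rewrite /cox !evE => /eqP u0'0; move: hu'; rewrite u0'0 eqxx.
- by move=> q' hq'; rewrite EB // FE evN mulrNN.
Qed.

End Rational.

(** * Classes of irreducible curves *)

Section Classes.
Variable k : closedFieldType.
Implicit Types (P Q G : {mpoly k[3 + 2]}) (q : point k) (D Y Z : subX k).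

(** Near q every equation of D is, up to a unit, a multiple of s, so a zero of s is a zero of all
    equations. *)
Lemma class_zero_set D L s : zclosed D -> section L s ->
  (forall q, D q -> s q = 0) ->
  (forall G : {mpoly k[3 + 2]}, is_bihomog G -> (forall q, D q -> ev G q = 0) ->
     forall q, onX q -> exists A B : {mpoly k[3 + 2]},
       [/\ is_bihomog A, is_bihomog B, ev A q != 0 &
           forall q', onX q' -> ev A q' * ev G q' = s q' * ev B q']) ->
  forall q, D q <-> onX q /\ s q = 0.
Proof.
move=> cD hs s0 gen q; split=> [Dq|[hq sq]].
  by split; [apply: zclosed_onX Dq|apply: s0].
have [S [hS hD]] := cD; apply/hD; split=> // G SG.
have [||//|A [B [_ _ A0 AB]]] := gen G _ _ q; first exact: hS.
  by move=> q' /hD[_]; apply.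
by apply: (mulfI A0); rewrite AB // sq mul0r mulr0.
Qed.

Lemma transverse (u0 u1 : k) : nz2 u0 u1 -> exists v0 v1, u0 * v1 - u1 * v0 != 0.
Proof.
move=> hu; have [u00|u00] := eqVneq u0 0.
  exists 1, 0; rewrite mulr0 mulr1 sub0r oppr_eq0.
  by move: hu; rewrite /nz2 u00 eqxx.
by exists 0, 1; rewrite mulr0 mulr1 subr0.
Qed.

(** Where s is forced to vanish along [E] or along a fibre, D contains that curve and equals it by
    dimension. The coefficients of L are then read off by restricting s to curves whose intersection
    with D is known. *)
Lemma irreducible_curve_class D (L : cls) : irreducible_curve D -> has_class D L ->
  L = E \/ L = f \/ (L.2 <= 0 /\ 1 <= L.1 + L.2).
Proof.
move=> cD [s [hs s0 gen]].
have [[clD [q0 Dq0] _] _ _] := cD.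
have DE := class_zero_set clD hs s0 gen.
have dn : (1 : k) * 1 - 0 * 0 != 0 by rewrite !(mulr0, mulr1, subr0) oner_neq0.
have n10 : nz2 (1 : k) 0 by exact: nz2_1l.
have [L2|L2] := ltrP 0 L.2.
  have E0 a b : nz2 a b -> s (Eparam 1 0 0 1 a b) = 0.
    by apply: (P1sec_neg (param_section (Eparam_param dn) hs)); lia.
  have DEc q : D q <-> Ecurve q.
    suff ED : incl (@Ecurve k) D.
      by split=> [|/ED//]; apply: irreducible_curve_incl (Ecurve_irreducible k) cD ED _.
    move=> {}q Eq; have [hq _ _] := Eq; have /(Ecurve_param _ dn)[v [w [hv e]]] := Eq.
    apply/DE; split=> //; apply/eqP.
    by rewrite (same_section0 hs e) ?E0 //; apply: param_onX (Eparam_param dn) _ _ hv.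
  (* On the fibre u = (1, 0), x0 = e is a local parameter at the point of [E]; x0 vanishes on D, so
     s divides it up to a unit and has a simple zero. *)
  have d1 : 1%:Z * (L.1 + L.2) + 0%:Z * (- L.2) = 1.
    pose q := Fparam (1 : k) 0 1 0.
    have hF v w : nz2 v w -> onX (Fparam (1 : k) 0 v w).
      exact: param_onX (Fparam_param n10) _ _.
    have sF v w : nz2 v w -> s (Fparam 1 0 v w) = 0 <-> w = 0.
      move=> hv; rewrite -(@Ecurve_cox k 1 0 w v) ?hF //; last exact: hF.
      by rewrite -DEc DE; split=> [|[]] //; split=> //; apply: hF.
    have [A [B [_ _ A0 AB]]] : exists A B : {mpoly k[3 + 2]},
       [/\ is_bihomog A, is_bihomog B, ev A q != 0 &
           forall q', onX q' -> ev A q' * ev 'X_ix0 q' = s q' * ev B q'].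
      apply: gen; last by apply: hF; exact: nz2_1l.
        by exists 1%N, 0%N; apply: bihomogx.
      by move=> q' /DEc[].
    have [pA hA] := poly_path_ev A (param_l (Fparam_param n10)).
    have [pB hB] := poly_path_ev B (param_l (Fparam_param n10)).
    apply: (P1sec_simple_zero (A := pA) (B := pB) (param_section (Fparam_param n10) hs)).
    - by apply/eqP => /(sF _ _ (nz2_1r _))/eqP; rewrite oner_eq0.
    - by move=> t; apply: sF; exact: nz2_1l.
    - by rewrite -hA.
    - move=> t; rewrite -hA -hB -AB; last by apply: hF; exact: nz2_1l.
      by rewrite /Fparam /cox !evE mulr1.
  (* The line z = 0 is disjoint from [E], so s has no zero on it. *)
  have d2 : 1%:Z * (L.1 + L.2) + 1%:Z * (- L.2) = 0.
    apply: (P1sec_nozero (param_section (Lparam_param k) hs)) => v w hv.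
    apply/eqP => sv; have hX := param_onX (Lparam_param k) hv.
    have /DEc[_] : D (Lparam v w) by apply/DE.
    by rewrite /Lparam !evE => v0 w0; move: hv; rewrite /nz2 v0 w0 eqxx.
  left; move: d1 d2; rewrite /E; case: (L) => L1 L2' /= d1 d2.
  by congr (_, _); lia.
have [d1|d0] := lerP 1 (L.1 + L.2); first by right; right.
right; left.
have hq0 := zclosed_onX clD Dq0.
have [u0 [u1 [e0 [z0 [Q0 hu hz]]]]] := onX_coxP hq0.
have hF v0 v1 v w : nz2 v0 v1 -> nz2 v w -> onX (Fparam v0 v1 v w).
  by move=> hv hw; apply: param_onX (Fparam_param hv) _ _ hw.
have Fneg v0 v1 v w : L.1 + L.2 < 0 -> nz2 v0 v1 -> nz2 v w -> s (Fparam v0 v1 v w) = 0.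
  by move=> dn0 hv; apply: (P1sec_neg (param_section (Fparam_param hv) hs)); lia.
(* In degree 0 the section is constant on the fibre, and it vanishes at the point q0 of D. *)
have F0 v w : nz2 v w -> s (Fparam u0 u1 v w) = 0.
  have [dn0|dp] := ltrP (L.1 + L.2) 0; first by apply: Fneg.
  move=> hv; have hP := param_section (Fparam_param hu) hs.
  have dz : 1%:Z * (L.1 + L.2) + 0%:Z * (- L.2) = 0 by lia.
  rewrite dz in hP; rewrite (P1sec_const hP) // -(P1sec_const hP (a := z0) (b := e0)).
    by rewrite /Fparam -Q0; apply: s0.
  by rewrite /nz2 andbC.
have DF q : D q <-> Fcurve u0 u1 q.
  suff FD : incl (Fcurve u0 u1) D.
    by split=> [|/FD//]; apply: irreducible_curve_incl (Fcurve_irreducible hu) cD FD _.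
  move=> {}q Fq; have [hq _] := Fq; have /(Fcurve_param _ hu)[v [w [hv e]]] := Fq.
  apply/DE; split=> //; apply/eqP.
  by rewrite (same_section0 hs e) ?F0 //; apply: hF.
have [v0 [v1 dv]] := transverse hu.
have Ez a b : nz2 a b -> s (Eparam u0 u1 v0 v1 a b) = 0 <-> b = 0.
  move=> hab; have hX := param_onX (Eparam_param dv) hab.
  have -> : s (Eparam u0 u1 v0 v1 a b) = 0 <-> Fcurve u0 u1 (Eparam u0 u1 v0 v1 a b).
    by rewrite -DF DE; split=> [|[]].
  have -> : Fcurve u0 u1 (Eparam u0 u1 v0 v1 a b) <-> b * (u0 * v1 - u1 * v0) = 0.
    rewrite /Fcurve /Fform /Eparam !evE.
    have -> : u0 * (a * u1 + b * v1) - u1 * (a * u0 + b * v0) = b * (u0 * v1 - u1 * v0) by ring.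
    by split=> [[]|].
  split=> [/eqP|->]; last by rewrite mul0r.
  by rewrite mulf_eq0 (negPf dv) orbF => /eqP.
(* In negative degree s would also vanish on the fibre over v, whose point on [E] is not in D. *)
have dge : L.1 + L.2 = 0.
  apply/eqP; rewrite eq_le; apply/andP; split; first lia.
  rewrite leNgt; apply/negP => dn0.
  have hv : nz2 v0 v1 by apply: contra dv => /andP[/eqP-> /eqP->]; rewrite !mulr0 subrr.
  have := Fneg v0 v1 1 0 dn0 hv (nz2_1l _).
  have -> : Fparam v0 v1 1 0 = Eparam u0 u1 v0 v1 0 1.
    by rewrite /Fparam /cox /Eparam; congr pt; ring.
  by move/(Ez _ _ (nz2_1r _))/eqP; rewrite oner_eq0.
(* [E] is transverse to the fibre: the equation of the fibre restricts to t times the determinant of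
   u and v, hence the rescaling of [pA] below. *)
have d1 : 0%:Z * (L.1 + L.2) + 1%:Z * (- L.2) = 1.
  pose q := Eparam u0 u1 v0 v1 1 0.
  have hE a b : nz2 a b -> onX (Eparam u0 u1 v0 v1 a b).
    exact: param_onX (Eparam_param dv) _ _.
  have [A [B [_ _ A0 AB]]] : exists A B : {mpoly k[3 + 2]},
     [/\ is_bihomog A, is_bihomog B, ev A q != 0 &
         forall q', onX q' -> ev A q' * ev (Fform u0 u1) q' = s q' * ev B q'].
    apply: gen; last by apply: hE; exact: nz2_1l.
      by exists 0%N, 1%N; apply: Fform_bihomog.
    by move=> q' /DF[].
  have [pA hA] := poly_path_ev A (param_l (Eparam_param dv)).
  have [pB hB] := poly_path_ev B (param_l (Eparam_param dv)).
  apply: (P1sec_simple_zero (A := (u0 * v1 - u1 * v0) *: pA) (B := pB)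
    (param_section (Eparam_param dv) hs)).
  - by apply/eqP => /(Ez _ _ (nz2_1r _))/eqP; rewrite oner_eq0.
  - by move=> t; apply: Ez; exact: nz2_1l.
  - by rewrite hornerZ mulf_neq0 // -hA.
  - move=> t; rewrite hornerZ -hA -hB -AB; last by apply: hE; exact: nz2_1l.
    by rewrite {3}/Eparam /Fform !evE; ring.
move: dge d1; rewrite /f /E /H; case: (L) => L1 L2' /= dge d1.
have -> : L1 = 1 by lia.
by have -> : L2' = -1 by lia.
Qed.

Lemma Qnef_numeric (L : Qcls) : Qnef k L <-> 0 <= - L.2 /\ 0 <= L.1 + L.2.
Proof.
split=> [h|[h1 h2] C c hC hc].
  have := h _ _ (Ecurve_irreducible k) (Ecurve_class k).
  have := h _ _ (Fcurve_irreducible (nz2_1r 0)) (Fcurve_class k).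
  rewrite /inter /toQ /= ?mulr0 ?mulr1 ?sub0r => a b.
  by rewrite mulrN1z mulrN mulr1 opprK in a.
rewrite /inter /toQ /=.
have [->|[->|[c1 c2]]] := irreducible_curve_class hC hc.
- by rewrite /= mulr0 mulr1 sub0r.
- by rewrite /= mulr1 mulrN1z mulrN mulr1 opprK.
have {}c1 : (c.2%:~R : rat) <= 0 by rewrite -[0]/(0%:~R) ler_int.
have {}c2 : 0 <= (c.1%:~R : rat) + c.2%:~R by rewrite -intrD -[0]/(0%:~R) ler_int; lia.
(* With C of class c, this is L.C = (L.f)(C.E) + (L.f + L.E)(C.f), where all factors are
   nonnegative. *)
have -> : L.1 * c.1%:~R - L.2 * c.2%:~R =
  (L.1 + L.2) * (- c.2%:~R) + (L.1 + L.2 + - L.2) * (c.1%:~R + c.2%:~R) :> rat by ring.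
by rewrite addr_ge0 // mulr_ge0 //; lra.
Qed.

End Classes.

(** * Ampleness and bigness *)

Lemma pair_mulrn (U V : zmodType) (L : U * V) n : L *+ n = (L.1 *+ n, L.2 *+ n).
Proof. by case: L => a b; elim: n => // n IH; rewrite !mulrS IH. Qed.

Section Positivity.
Variable k : closedFieldType.
Implicit Types (P Q G : {mpoly k[3 + 2]}) (q : point k).

(** Negative degree on the curve contradicts the absence of base points, and in degree 0 all
    sections are constant along it. The inverse polynomials chosen near [g 0 1] then take equal
    values at both points, so the points have proportional coordinates. *)
Lemma very_ample_param L g a b : very_ample k L -> param g a b ->
  a%:Z * (L.1 + L.2) + b%:Z * (- L.2) <= 0 ->
  exists lx lu lx' lu' : k, [/\ lx != 0, lu != 0,
    forall i, lx * (g 0 1).1 0 i = lx' * (g 1 0).1 0 i &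
    forall j, lu * (g 0 1).2 0 j = lu' * (g 1 0).2 0 j].
Proof.
move=> [N [s [hs bpf inv]]] hg; set d := (_ + _) => hd.
have hP i : P1sec d (fun v w => s i (g v w)) := param_section hg (hs i).
have h01 : onX (g 0 1) by apply: (param_onX hg); apply: nz2_1r.
have h10 : onX (g 1 0) by apply: (param_onX hg); apply: nz2_1l.
have d0 : d = 0.
  apply/eqP; rewrite eq_le hd leNgt; apply/negP => dn.
  have [i /eqP[]] := bpf _ h01.
  by rewrite (P1sec_neg (hP i) dn) // nz2_1r.
have E i : s i (g 1 0) = s i (g 0 1).
  by have := hP i; rewrite d0 => /P1sec_const; apply; apply: nz2_1l.
have [dx [du [Ax [Au [_ _ [i Axi] [j Auj] h]]]]] := inv _ h01.
have [lx [lu [hx hu]]] := h _ h01.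
have [lx' [lu' [hx' hu']]] := h _ h10.
have Em (A : {mpoly k[N]}) : A.@[fun l => s l (g 1 0)] = A.@[fun l => s l (g 0 1)].
  by apply: meval_eq => l; rewrite E.
exists lx, lu, lx', lu'; split.
- by apply: contraNneq Axi => l0; rewrite hx l0 mul0r.
- by apply: contraNneq Auj => l0; rewrite hu l0 mul0r.
- by move=> i'; rewrite -hx -hx' Em.
- by move=> j'; rewrite -hu -hu' Em.
Qed.

Lemma very_ample_gt0 L : very_ample k L -> 0 < - L.2 /\ 0 < L.1 + L.2.
Proof.
move=> hL; split; rewrite ltNge; apply/negP => hd.
  have dn : (1 : k) * 1 - 0 * 0 != 0 by rewrite !(mulr0, mulr1, subr0) oner_neq0.
  have [|lx [lu [lx' [lu' [_ lu0 _ h]]]]] := very_ample_param hL (Eparam_param dn); first lia.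
  have := h (inord 1); rewrite !mxE !inordK //= !(mul0r, mulr0, add0r, addr0, mul1r, mulr1).
  by move=> lu00; rewrite lu00 eqxx in lu0.
have [|lx [lu [lx' [lu' [lx0 _ h _]]]]] := very_ample_param hL (Fparam_param (nz2_1l (0 : k))); first lia.
have := h (inord 0); rewrite !mxE !inordK //= !(mul0r, mulr0, add0r, addr0, mul1r, mulr1).
by move=> lx00; rewrite lx00 eqxx in lx0.
Qed.

Lemma vec_neq0 n (v : 'rV[k]_n) : v != 0 -> exists i, v 0 i != 0.
Proof.
move=> v0; apply: NNPP => h; case/eqP: v0; apply/rowP => i; rewrite mxE.
by apply/eqP/negPn/negP => vi; apply: h; exists i.
Qed.

(** A Segre-Veronese embedding by the monomials x_i x_j^p u_l u_m^q, with p + 1 = L.f and q + 1 =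
    L.E. Where x_i and u_j are nonzero, letting one linear factor vary and keeping the others equal
    to x_i and u_j recovers x and u up to scalars. *)
Lemma very_ample_of_gt0 L : 0 < - L.2 -> 0 < L.1 + L.2 -> very_ample k L.
Proof.
move=> hq hp.
have [q Eq] : exists q : nat, - L.2 = q.+1%:Z by exists (absz (- L.2)).-1; lia.
have [p Ep] : exists p : nat, L.1 + L.2 = p.+1%:Z by exists (absz (L.1 + L.2)).-1; lia.
pose T : finType := ('I_3 * 'I_3 * ('I_2 * 'I_2))%type.
pose F (t : T) : {mpoly k[3 + 2]} := 'X_(lshift 2 t.1.1) * 'X_(lshift 2 t.1.2) ^+ p
  * ('X_(rshift 3 t.2.1) * 'X_(rshift 3 t.2.2) ^+ q).
have FE t q' : ev (F t) q' = q'.1 0 t.1.1 * q'.1 0 t.1.2 ^+ p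
    * (q'.2 0 t.2.1 * q'.2 0 t.2.2 ^+ q).
  by rewrite /F !evE /ev !mevalXU !row_mxEl !row_mxEr.
exists #|T|, (fun l => ev (F (enum_val l))); split.
- move=> l; apply: (@sectionE _ _ p.+1 q.+1) => //.
  apply: (bihomog_eq (bihomogM (bihomogM (@bihomogx k _) (bihomogXn p (@bihomogx k _)))
    (bihomogM (@bihomogu k _) (bihomogXn q (@bihomogu k _))))); lia.
- move=> q' [/vec_neq0[i xi] /vec_neq0[j uj] _].
  exists (enum_rank (i, i, (j, j))); rewrite enum_rankK FE /=.
  by rewrite !mulf_neq0 // expf_neq0.
- move=> q' [/vec_neq0[i xi] /vec_neq0[j uj] _].
  exists 1%N, 1%N, (fun i' => 'X_(enum_rank (i', i, (j, j)))),
    (fun j' => 'X_(enum_rank (i, i, (j', j)))); split.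
  + by move=> i' m; rewrite msuppX mem_seq1 => /eqP->; rewrite mdeg1.
  + by move=> i' m; rewrite msuppX mem_seq1 => /eqP->; rewrite mdeg1.
  + exists i; rewrite mevalXU enum_rankK FE /=.
    by rewrite !mulf_neq0 // expf_neq0.
  + exists j; rewrite mevalXU enum_rankK FE /=.
    by rewrite !mulf_neq0 // expf_neq0.
  move=> q'' _; exists (q''.1 0 i ^+ p * (q''.2 0 j * q''.2 0 j ^+ q)),
    (q''.1 0 i * q''.1 0 i ^+ p * q''.2 0 j ^+ q).
  by split=> l; rewrite mevalXU enum_rankK FE /=; ring.
Qed.

Lemma ampleE L : ample k L <-> 0 < - L.2 /\ 0 < L.1 + L.2.
Proof.
split=> [[n [n0]]|[h1 h2]]; last first.
  by exists 1%N; split=> //; rewrite mulr1n; apply: very_ample_of_gt0.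
rewrite pair_mulrn => /very_ample_gt0[/=]; rewrite -mulNrn -mulrnDl.
by rewrite !pmulrn_lgt0.
Qed.

(** A section is constant on each fibre (zero in negative degree), hence determined by its value at
    z = 1, e = 0, on [E]. There it is a binary form of degree - L.2, with at most |L.2| + 1
    coefficients. *)
Lemma h0_ge_le L r : L.1 + L.2 <= 0 -> h0_ge k L r -> (r <= (absz L.2).+1)%N.
Proof.
move=> hp [s [hs free]]; rewrite leqNgt; apply/negP => rn.
pose d := absz L.2.
have dn : (1 : k) * 1 - 0 * 0 != 0 by rewrite !(mulr0, mulr1, subr0) oner_neq0.
pose g i := fun v w => s i (Eparam 1 0 0 1 v w).
have hg i : P1sec (- L.2) (g i).
  by have := param_section (Eparam_param dn) (hs i); rewrite mul0r add0r mul1r.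
have [p hp'] : exists p : 'I_r -> {poly k}, forall i,
    [/\ forall t, g i 1 t = (p i).[t], (size (p i) <= d.+1)%N & g i 0 1 = (p i)`_d].
  apply: (@fin_all_exists _ (fun=> {poly k}) (fun i p => [/\ forall t, g i 1 t = p.[t],
    (size p <= d.+1)%N & g i 0 1 = p`_d])) => i.
  have [p [h1 h2 h3]] := P1sec_poly (hg i); exists p.
  have [dneg|dpos] := ltrP (- L.2) 0.
    have [p0 g0] := h3 dneg; split=> //; first by rewrite p0 size_poly0.
    by rewrite g0 p0 coef0.
  by have [|a b] := h2 d; [rewrite /d; lia|split].
pose M : 'M[k]_(r, d.+1) := \matrix_(i, j) (p i)`_j.
have : kermx M != 0.
  rewrite kermx_eq0 /row_free; apply/eqP => E.
  by have := rank_leq_col M; rewrite E leqNgt rn.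
move/rowV0Pn => [c /sub_kermxP cM c0].
have pc : \sum_i c 0 i *: p i = 0.
  apply/polyP => j; rewrite coef_sum coef0.
  have [jd|jd] := ltnP j d.+1.
    have := congr1 (fun A : 'rV_(d.+1) => A 0 (Ordinal jd)) cM.
    by rewrite !mxE => E; rewrite -[RHS]E; apply: eq_bigr => i _; rewrite coefZ mxE.
  rewrite big1 // => i _; rewrite coefZ nth_default ?mulr0 //.
  by have [_ h _] := hp' i; apply: leq_trans h jd.
have Ez v w : nz2 v w -> \sum_i c 0 i * g i v w = 0.
  have [->|v0] := eqVneq v 0 => hv.
    have w0 : w != 0 by move: hv; rewrite /nz2 eqxx.
    under eq_bigr => i _.
      have -> : g i 0 w = w ^ (- L.2) * (p i)`_d.
        have [_ _ <-] := hp' i; rewrite -(P1_hom (hg i)) ?nz2_1r //.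
        by rewrite mulr0 mulr1.
      rewrite mulrCA -coefZ; over.
    by rewrite -mulr_sumr -coef_sum pc coef0 mulr0.
  under eq_bigr => i _.
    have -> : g i v w = v ^ (- L.2) * (p i).[w / v].
      have [<- _ _] := hp' i; rewrite -(P1_hom (hg i)) ?nz2_1l //.
      by rewrite mulr1 mulrC divfK.
    rewrite mulrCA -hornerZ; over.
  by rewrite -mulr_sumr -horner_sum pc horner0 mulr0.
case/eqP: c0; apply/rowP => i; rewrite mxE; apply: (free (fun i => c 0 i)) => q hq.
have [u0 [u1 [e [z [-> hu hz]]]]] := onX_coxP hq.
rewrite -[RHS](Ez u0 u1 hu); apply: eq_bigr => {}i _; congr (_ * _).
have hF := param_section (Fparam_param hu) (hs i).
rewrite mul1r mul0r addr0 in hF.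
have -> : g i u0 u1 = s i (Fparam u0 u1 1 0).
  by rewrite /g /Eparam /Fparam /cox; congr (s i (pt _ _ _ _ _)); ring.
have hz' : nz2 z e by rewrite /nz2 andbC.
rewrite -/(Fparam u0 u1 z e).
have [pneg|ppos] := ltrP (L.1 + L.2) 0.
  by rewrite (P1sec_neg hF pneg (nz2_1l 0)) (P1sec_neg hF pneg hz').
have E0 : L.1 + L.2 = 0 by apply/eqP; rewrite eq_le hp.
rewrite E0 in hF; have h1 := P1sec_const hF hz'; have h2 := P1sec_const hF (nz2_1l 0).
by rewrite /= in h1 h2; rewrite h1 h2.
Qed.

Lemma big_gt0 L : big k L -> 0 < L.1 + L.2.
Proof.
move=> [N [N0 h]]; rewrite ltNge; apply/negP => hp.
(* Chosen so that n^2 exceeds N times the linear bound n |L.2| + 1 on h^0(n L). *)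
have [n [r [nn nr hr]]] := h (N * (absz L.2).+1).+1.
have := h0_ge_le _ hr; rewrite pair_mulrn /= => /(_ _).
rewrite -mulrnDl mulrn_wle0 // => /(_ isT).
have -> : absz (L.2 *+ n) = (n * absz L.2)%N by rewrite -mulr_natr abszM natz absz_nat mulnC.
move=> rb; have n0 : (0 < n)%N by apply: leq_trans nn.
have : (n ^ 2 <= N * (n * (absz L.2).+1))%N.
  by apply: leq_trans nr _; rewrite leq_mul2l; apply/orP; right; nia.
rewrite -mulnn mulnCA leq_pmul2l // leqNgt nn //.
Qed.

(** For n = 2 n0 the degree of n L in x is at least n, which leaves room for the n0^2 monomials in
    x0 and x1 with both exponents below n0; the constant 4 is n^2 / n0^2. *)
Lemma big_of_gt0 L : 0 < L.1 + L.2 -> 0 <= - L.2 -> big k L.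
Proof.
move=> hp hq; exists 4; split=> // n0.
have [q Eq] : exists q : nat, - L.2 = q%:Z by exists (absz (- L.2)); lia.
have [p Ep] : exists p : nat, L.1 + L.2 = p.+1%:Z by exists (absz (L.1 + L.2)).-1; lia.
exists (2 * n0)%N, (n0 * n0)%N; split; [lia|nia|].
pose n := (2 * n0)%N; pose T : finType := ('I_n0 * 'I_n0)%type.
have cT : #|T| = (n0 * n0)%N by rewrite card_prod !card_ord.
pose F (t : T) : {mpoly k[3 + 2]} :=
  'X_ix0 ^+ t.1 * ('X_ix1 ^+ t.2 * 'X_ix2 ^+ (p.+1 * n - t.1 - t.2)) * 'X_iu1 ^+ (q * n).
have hF t : bihomog (p.+1 * n) (q * n) (F t).
  have := ltn_ord t.1; have := ltn_ord t.2 => l1 l2.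
  apply: bihomog_eq (bihomogM (bihomogM (bihomogXn _ (@bihomogx k _))
    (bihomogM (bihomogXn _ (@bihomogx k _)) (bihomogXn _ (@bihomogx k _))))
    (bihomogXn _ (@bihomogu k _))) _ _; last by lia.
  have : (2 * n0 <= p.+1 * n)%N by rewrite /n; nia.
  rewrite !muln1; lia.
rewrite -cT; exists (fun i => ev (F (enum_val i))); split.
  move=> i; apply: sectionE (hF _) _ _; rewrite pair_mulrn /=.
    by rewrite -mulrnDl Ep; lia.
  by rewrite -mulNrn Eq; lia.
move=> c h.
have ord_poly m (d : 'I_m -> k) : (forall t, t != 0 -> \sum_(i < m) d i * t ^+ i = 0) ->
    forall i, d i = 0.
  case: m d => [d _ []//|m d hd i].
  have E : \poly_(i < m.+1) d (inord i) = 0.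
    apply: poly_ext_neq0 => t t0; rewrite horner0 -[RHS](hd t t0) horner_poly.
    by apply: eq_bigr => j _; rewrite inord_val.
  by have := congr1 (fun r : {poly k} => r`_i) E; rewrite coef_poly coef0 ltn_ord inord_val.
pose c' (i j : 'I_n0) := c (enum_rank (i, j)).
(* At points with e = z = 1 the monomials become a^i b^(j + q n), so coefficients can be compared in
   a and then in b. *)
have E a b : b != 0 ->
    \sum_(i < n0) (\sum_(j < n0) c' i j * b ^+ j) * b ^+ (q * n) * a ^+ i = 0.
  move=> b0; have hX : onX (cox a b 1 1) by rewrite onX_cox oner_eq0 (negPf b0) andbF.
  rewrite -[RHS](h _ hX) (reindex (@enum_rank T)) /=; last first.
    by exists enum_val => i _; rewrite ?enum_rankK ?enum_valK.
  under eq_bigr do rewrite !mulr_suml.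
  rewrite pair_bigA; apply: eq_bigr => -[i j] _.
  by rewrite enum_rankK /F /cox !evE /c' /= !mul1r expr1n; ring.
have c0 i j : c' i j = 0.
  apply: (ord_poly _ (fun j => c' i j)) => b b0.
  have h' := ord_poly _ (fun i => (\sum_(j < n0) c' i j * b ^+ j) * b ^+ (q * n)).
  have /eqP := h' (fun t _ => E t b b0) i.
  by rewrite mulf_eq0 (negPf (expf_neq0 _ b0)) orbF => /eqP.
by move=> i; rewrite -[i]enum_valK; case: (enum_val i) => i1 i2; apply: c0.
Qed.

Definition lift_denq (L : Qcls) : cls := (numq L.1 * denq L.2, numq L.2 * denq L.1).

Lemma toQ_lift (L : Qcls) :
  exists n : nat, (0 < n)%N /\ toQ (lift_denq L) = L *+ n.
Proof.
exists (absz (denq L.1 * denq L.2)); split.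
  by rewrite absz_gt0 mulf_neq0 // ?denq_eq0.
have En : ((absz (denq L.1 * denq L.2))%:R : rat) = (denq L.1)%:~R * (denq L.2)%:~R.
  by rewrite -intrM pmulrn gtz0_abs // mulr_gt0.
by rewrite pair_mulrn; congr (_, _); rewrite -[RHS]mulr_natr En /= intrM numqE; ring.
Qed.

Lemma toQ_gt0 (M : cls) (L : Qcls) n : (0 < n)%N -> toQ M = L *+ n ->
  (0 < - M.2) = (0 < - L.2) /\ (0 < M.1 + M.2) = (0 < L.1 + L.2).
Proof.
move=> n0; rewrite pair_mulrn /toQ => -[E1 E2]; split.
  by rewrite -(ltr0z rat) intrN E2 -mulNrn pmulrn_lgt0.
by rewrite -(ltr0z rat) intrD E1 E2 -mulrnDl pmulrn_lgt0.
Qed.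

Lemma QampleE (L : Qcls) : Qample k L <-> 0 < - L.2 /\ 0 < L.1 + L.2.
Proof.
split=> [[n [M [n0 EM]]]|[h1 h2]].
  by rewrite ampleE; have [-> ->] := toQ_gt0 n0 EM.
have [n [n0 EM]] := toQ_lift L; exists n, (lift_denq L); split=> //.
by rewrite ampleE; have [-> ->] := toQ_gt0 n0 EM.
Qed.

Lemma QbigE (L : Qcls) : 0 <= - L.2 -> (Qbig k L <-> 0 < L.1 + L.2).
Proof.
move=> hq; split=> [[n [M [n0 EM /big_gt0]]]|hp].
  by have [_ ->] := toQ_gt0 n0 EM.
have [n [n0 EM]] := toQ_lift L; exists n, (lift_denq L); split=> //.
apply: big_of_gt0; first by have [_ ->] := toQ_gt0 n0 EM.
move: EM; rewrite pair_mulrn => -[_ E2].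
by rewrite -(ler0z rat) intrN E2 -mulNrn pmulrn_lge0.
Qed.

End Positivity.

(** * Eisenstein's criterion *)

Section Eisenstein.
Variables (k : closedFieldType) (p n : nat).
Hypothesis p_gt0 : (0 < p)%N.
Hypothesis two_neq0 : (2 : k) != 0.
Hypothesis two_p : (2 : k) ^+ p != 1.

(** The inner variable is y and the outer one w: [eisF] is w^p - y (1 + y)^n, an Eisenstein
    polynomial at y = 0. *)
Definition eisC : {poly k} := 'X * (1 + 'X) ^+ n.
Definition eisF : {poly {poly k}} := 'X^p - eisC%:P.

Lemma size_eisF : size eisF = p.+1.
Proof.
by rewrite size_polyDl size_polyXn // size_polyN (leq_ltn_trans (size_polyC_leq1 _)).
Qed.

Lemma monic_eisF : eisF \is monic.
Proof.
by rewrite monicE lead_coefDl ?lead_coefXn // size_polyXn size_polyN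
  (leq_ltn_trans (size_polyC_leq1 _)).
Qed.

(* The substitution (y, w) := (s^p, a s), homogeneous for the weights giving
   the Newton polygon of eisF. *)
Definition newton (a : k) (h : {poly {poly k}}) : {poly k} :=
  (map_poly (comp_poly 'X^p) h).[a *: 'X].

Lemma newtonM a g h : newton a (g * h) = newton a g * newton a h.
Proof. by rewrite /newton rmorphM hornerM. Qed.

(** Both w^p and y have weight p, so the coefficient at the lowest weight is a^p - 1, which depends
    on a. *)
Lemma newton_eisF a : newton a eisF = 'X^p * ((a ^+ p)%:P - (1 + 'X^p) ^+ n).
Proof.
rewrite /newton /eisF rmorphB /= map_polyXn map_polyC hornerD hornerN hornerC hornerXn.
rewrite /eisC /= comp_polyM comp_polyX rmorphXn /= comp_polyD comp_polyC comp_polyX.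
by rewrite exprZn mulrBr -mul_polyC mulrC.
Qed.

(** The monomial y^l w^i has weight l p + i, and i < p makes this the Euclidean division of the
    weight by p. *)
Lemma newton_coef a (h : {poly {poly k}}) j : (size h <= p)%N ->
  (newton a h)`_j = a ^+ (j %% p) * (h`_(j %% p))`_(j %/ p).
Proof.
move=> hp; have jp : (j %% p < p)%N by rewrite ltn_mod.
rewrite /newton (@horner_coef_wide _ p); last by rewrite (leq_trans (size_poly _ _)).
rewrite coef_sum (bigD1 (Ordinal jp)) //= big1 ?addr0.
  rewrite coef_map /= exprZn -scalerAr coefZ coefMXn ltnNge leq_mod /=.
  have jE : (j - j %% p = j %/ p * p)%N by rewrite {1}(divn_eq j p) addnK.
  by rewrite coef_comp_poly_Xn // jE dvdn_mull // mulnK.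
move=> i /eqP ij; rewrite coef_map /= exprZn -scalerAr coefZ coefMXn.
case: ltnP => ji; first by rewrite mulr0.
rewrite coef_comp_poly_Xn //; case: ifP; rewrite ?mulr0 // => /dvdnP[c jc].
case: ij; apply: val_inj => /=.
by rewrite -(subnK ji) jc modnMDl modn_small.
Qed.

(* On polynomials of w-degree < p, distinct monomials have distinct weights, so
   the order does not depend on a. *)
Lemma newton_order (h : {poly {poly k}}) : h != 0 -> (size h <= p)%N ->
  exists m, forall a : k, a != 0 -> exists2 q : {poly k}, newton a h = 'X^m * q & q.[0] != 0.
Proof.
move=> h0 hp; have ex : exists j, (h`_(j %% p))`_(j %/ p) != 0.
  apply: NNPP => nex; case/eqP: h0; apply/polyP => i; rewrite coef0.
  have [ip|ip] := ltnP i p; last by rewrite nth_default // (leq_trans hp).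
  apply/polyP => l; rewrite coef0; apply/eqP/negPn/negP => hl; apply: nex.
  by exists (l * p + i)%N; rewrite modnMDl modn_small // divnMDl // divn_small ?addn0.
have [m hm min] := ex_minnP ex; exists m => a a0.
exists (drop_poly m (newton a h)).
  rewrite -{1}(poly_take_drop m (newton a h)) mulrC.
  suff -> : take_poly m (newton a h) = 0 by rewrite add0r.
  apply/polyP => i; rewrite coef_take_poly coef0; case: ltnP => // im.
  rewrite newton_coef //; have [->|hi] := eqVneq (h`_(i %% p))`_(i %/ p) 0; first by rewrite mulr0.
  by have := min _ hi; rewrite leqNgt im.
by rewrite horner_coef0 coef_drop_poly add0n newton_coef // mulf_neq0 // expf_neq0.
Qed.

Lemma Xn_mul_inj (m m' : nat) (u v : {poly k}) : 'X^m * u = 'X^m' * v -> u.[0] != 0 ->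
  v.[0] != 0 -> m = m' /\ u = v.
Proof.
have Xn0 l : 'X^l != 0 :> {poly k} by rewrite -size_poly_eq0 size_polyXn.
suff le (a b : nat) (r s : {poly k}) : 'X^a * r = 'X^b * s -> r.[0] != 0 -> s.[0] != 0 ->
    (a <= b)%N.
  move=> E u0 v0; have mm : m = m'.
    by apply/eqP; rewrite eqn_leq (le _ _ _ _ E) // (le _ _ _ _ (esym E)).
  by split=> //; apply: (mulfI (Xn0 m)); rewrite E mm.
move=> E r0 s0; rewrite leqNgt; apply/negP => ba.
case/negP: s0; apply/eqP; have -> : s = 'X^(a - b) * r.
  by apply: (mulfI (Xn0 b)); rewrite -E mulrA -exprD subnKC // ltnW.
by rewrite !hornerE -[(a - b)%N]prednK ?subn_gt0 // expr0n mul0r.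
Qed.

(** A common factor d of positive degree gives c F = h d with h and d of w-degree below p. The
    orders of c, h and d under the substitution do not depend on a, but that of F does: it is p for
    a = 2 and larger, or infinite, for a = 1. *)
Lemma eisF_coprime (r : {poly {poly k}}) : r != 0 -> (size r <= p)%N -> coprimep eisF r.
Proof.
move=> r0 rp; set d := gcdp eisF r.
have F0 : eisF != 0 := monic_neq0 monic_eisF.
have d0 : d != 0 by rewrite gcdp_eq0 negb_and F0.
have dp : (size d <= p)%N by apply: leq_trans (dvdp_leq r0 (dvdp_gcdr _ _)) rp.
rewrite coprimep_def -/d; apply: contraT => d1.
(* Divisibility holds over the fraction field of k[y]; c clears the denominators and contributes its
   own order [m3]. *)
have /Pdiv.WeakIdomain.dvdpP[[c h] /= c0 E] : d %| eisF := dvdp_gcdl _ _.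
have cF : c%:P * eisF = h * d by rewrite mul_polyC.
have h0 : h != 0.
  apply: contraTneq c0 => h0; move/eqP: cF.
  by rewrite h0 mul0r mulf_eq0 (negPf F0) orbF polyC_eq0 => ->.
have hp : (size h <= p)%N.
  have := congr1 (fun q : {poly {poly k}} => size q) cF.
  rewrite !size_mul ?polyC_eq0 // size_eisF size_polyC c0 /=.
  have : (0 < size d)%N by rewrite size_poly_gt0.
  by move: d1; set a := size d; set b := size h; case: a => [|[|a]] //= _ _; rewrite add0n => Eb; rewrite -ltnS Eb addnS /= addnS ltnS leq_addr.
have [m1 hm1] := newton_order h0 hp; have [m2 hm2] := newton_order d0 dp.
have [m3 hm3] : exists m, forall a : k, a != 0 -> exists2 q : {poly k}, newton a c%:P = 'X^m * q & q.[0] != 0.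
  by apply: newton_order; rewrite ?polyC_eq0 // (leq_trans (size_polyC_leq1 _)).
have key (a : k) : a != 0 -> exists u v : {poly k}, [/\ u.[0] != 0, v.[0] != 0 &
    'X^(m1 + m2) * u = 'X^(m3 + p) * (v * ((a ^+ p)%:P - (1 + 'X^p) ^+ n))].
  move=> a0; have [q1 E1 Q1] := hm1 a a0; have [q2 E2 Q2] := hm2 a a0.
  have [q3 E3 Q3] := hm3 a a0; exists (q1 * q2), q3; split=> //.
    by rewrite hornerM mulf_neq0.
  have := congr1 (newton a) cF; rewrite !newtonM E1 E2 E3 newton_eisF => EE.
  by rewrite !exprD mulrACA -EE; ring.
have ev0 (a : k) : ((a ^+ p)%:P - (1 + 'X^p) ^+ n : {poly k}).[0] = a ^+ p - 1.
  by rewrite !hornerE expr0n eqn0Ngt p_gt0 addr0 expr1n.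
have [u [v [u0 v0 E2]]] := key _ two_neq0.
have [mm _] : (m1 + m2 = m3 + p)%N /\ u = v * ((2 ^+ p)%:P - (1 + 'X^p) ^+ n).
  by apply: Xn_mul_inj E2 _ _ => //; rewrite hornerM ev0 mulf_neq0 // subr_eq0.
have [u' [v' [u0' v0' E1]]] := key _ (oner_neq0 k).
move: E1; rewrite mm => /mulfI.
rewrite -size_poly_eq0 size_polyXn => /(_ isT) E1.
by move: u0'; rewrite E1 hornerM ev0 expr1n subrr mulr0 eqxx.
Qed.

End Eisenstein.

(** * Curves of given bidegree *)

Section Density.
Variable k : closedFieldType.
Implicit Types (P Q G B : {mpoly k[3 + 2]}) (q : point k).

Definition chart (y w : k) : point k := cox 1 y 1 w.

Lemma ev_chart a b P u0 u1 e z : bihomog a b P -> u0 != 0 -> e != 0 ->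
  ev P (cox u0 u1 e z) = (e * u0) ^+ a * u0 ^+ b * ev P (chart (u1 / u0) (z / (e * u0))).
Proof.
move=> hP u00 e0; rewrite -(ev_act _ _ _ hP); congr (ev P _).
by rewrite /chart /cox act_pt; congr pt; field; rewrite ?u00 ?e0.
Qed.

(** Shifting u0 and e by a common t turns P into a polynomial in t that vanishes except perhaps at -
    u0 and - e. *)
Lemma ev_cox_dense P : (forall u0 u1 e z, u0 != 0 -> e != 0 -> ev P (cox u0 u1 e z) = 0) ->
  forall q, onX q -> ev P q = 0.
Proof.
move=> h q /onX_coxP[u0 [u1 [e [z [-> _ _]]]]].
have [|p hp] := @poly_path_ev k (fun t => cox (u0 + t) u1 (e + t) z) P.
  exists ((e%:P + 'X) * (u0%:P + 'X)), ((e%:P + 'X) * u1%:P), z%:P, (u0%:P + 'X), u1%:P => t.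
  by rewrite !hornerE.
have p0 : p = 0.
  apply: (@poly_ext_cofinite _ (('X + u0%:P) * ('X + e%:P))).
    have Xc (c : k) : 'X + c%:P != 0 by rewrite -[c]opprK polyCN polyXsubC_eq0.
    by rewrite mulf_neq0.
  move=> t; rewrite !hornerE mulf_eq0 negb_or addrC [t + e]addrC => /andP[a b].
  by rewrite -hp h.
by have := hp 0; rewrite !addr0 p0 horner0.
Qed.

Lemma ev_chart_dense a b P : bihomog a b P -> (forall y w, ev P (chart y w) = 0) ->
  forall q, onX q -> ev P q = 0.
Proof.
move=> hP h; apply: ev_cox_dense => u0 u1 e z u00 e0.
by rewrite (ev_chart _ _ hP) // h mulr0.
Qed.

Lemma mmap1_row5 (A : comNzRingType) (a b c d e : A) (m : 'X_{1..3 + 2}) :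
  mmap1 (fun l => row5 a b c d e 0 l) m =
  a ^+ m ix0 * (b ^+ m ix1 * c ^+ m ix2) * (d ^+ m iu0 * e ^+ m iu1).
Proof.
rewrite /mmap1 big_split_ord !big_ord_recl !big_ord0 /= !mulr1.
rewrite /row5 !row_mxEl !row_mxEr !mxE /=.
by congr (_ ^+ m _ * (_ ^+ m _ * _ ^+ m _) * (_ ^+ m _ * _ ^+ m _));
  apply: val_inj; rewrite /= !inordK.
Qed.

(** Dehomogenisation, with inner variable y = u1 / u0 and outer variable w = x2 / x0. *)
Definition chart_poly P : {poly {poly k}} :=
  pull (@polyC {poly k} \o @polyC k) 1 'X%:P 'X 1 'X%:P P.

Lemma chart_polyP P y w : ev P (chart y w) = (chart_poly P).[w%:P].[y].
Proof.
rewrite /chart_poly -[RHS]/((horner_eval y \o horner_eval w%:P) _).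
rewrite pullP => [|x] /=; rewrite /horner_eval ?hornerC //.
by rewrite /chart /cox !hornerE.
Qed.

Lemma size_chart_poly a b P : bihomog a b P -> (size (chart_poly P) <= a.+1)%N.
Proof.
move=> hP; rewrite /chart_poly /pull /mmap big_seq.
apply: (leq_trans (size_sum _ _ _)); apply/bigmax_leqP_seq => m _ /hP[].
rewrite -/(wx m) => mx _; rewrite mmap1_row5 /= !expr1n !mul1r -!rmorphXn /=.
rewrite mulrAC -rmorphM /= mulrA -rmorphM /=.
apply: (leq_trans (size_polyMleq _ _)); rewrite size_polyXn.
have := size_polyC_leq1 ((P@_m)%:P * ('X ^+ m ix1 * 'X ^+ m iu1)).
have : (m ix2 <= a)%N by rewrite -mx /wx (bigD1 (inord 2)) //= leq_addr.
by move=> h; case: size => [|[|l]] //= _; apply: leqW.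
Qed.

End Density.

Section Curves.
Variables (k : closedFieldType) (p' c : nat).
Let p := p'.+1.
Hypothesis two_neq0 : (2 : k) != 0.
Hypothesis two_p : (2 : k) ^+ p != 1.
Implicit Types (P Q G B : {mpoly k[3 + 2]}) (q : point k).

(* z^p u0^c = e^p u1 (u0 + u1)^(p' + c), of class (p + c) H - c E. *)
Definition eis_form : {mpoly k[3 + 2]} :=
  'X_ix2 ^+ p * 'X_iu0 ^+ c - 'X_ix1 * ('X_ix0 + 'X_ix1) ^+ p' * ('X_iu0 + 'X_iu1) ^+ c.

Definition eis_curve : subX k := fun q => onX q /\ ev eis_form q = 0.

Lemma eis_form_bihomog : bihomog p c eis_form.
Proof.
apply: bihomogB.
  apply: (bihomog_eq (bihomogM (bihomogXn p (@bihomogx k _)) (bihomogXn c (@bihomogu k _)))); lia.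
have hx : bihomog 1 0 ('X_ix0 + 'X_ix1 : {mpoly k[3 + 2]}) by apply: bihomogD; apply: bihomogx.
have hu : bihomog 0 1 ('X_iu0 + 'X_iu1 : {mpoly k[3 + 2]}) by apply: bihomogD; apply: bihomogu.
apply: (bihomog_eq (bihomogM (bihomogM (@bihomogx k _) (bihomogXn p' hx)) (bihomogXn c hu))); lia.
Qed.

(** Of the p + c linear factors in u on the right, p absorb a factor e each and become x1 or x0 +
    x1; hence the bidegree (p, c) of [eis_form]. *)
Lemma eis_form_cox u0 u1 e z : ev eis_form (cox u0 u1 e z) =
  z ^+ p * u0 ^+ c - e ^+ p * (u1 * (u0 + u1) ^+ (p' + c)).
Proof. by rewrite /eis_form /cox !evE -mulrDr exprMn exprD /p !exprS; ring. Qed.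

Let eis := eisF k p (p' + c).

Lemma eis_form_chart y w : ev eis_form (chart y w) = eis.[w%:P].[y].
Proof.
rewrite eis_form_cox !expr1n mulr1 mul1r /eis /eisF /eisC.
by rewrite !hornerE.
Qed.

(* On the fibre u0 = 0 the equation of the curve is nonzero at a general point. *)
Lemma eis_fibre B : (forall q, onX q -> ev 'X_iu0 q = 0 -> ev eis_form q * ev B q = 0) ->
  forall q, onX q -> ev 'X_iu0 q = 0 -> ev B q = 0.
Proof.
move=> h q /onX_coxP[u0 [u1 [e [z [-> hu hz]]]]].
rewrite /cox !evE -/(cox u0 u1 e z) => u00; rewrite u00 eqxx /= in hu *.
have [|b hb] := @poly_path_ev k (fun t => cox 0 u1 (e + t) z) B.
  by exists 0, ((e%:P + 'X) * u1%:P), z%:P, 0, u1%:P => t; rewrite !hornerE /cox mulr0.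
pose a := z ^+ p * 0 ^+ c; pose d := u1 * u1 ^+ (p' + c).
pose F := a%:P - (e%:P + 'X) ^+ p * d%:P.
have d0 : d != 0 by rewrite mulf_neq0 ?expf_neq0.
have F0 : F != 0.
  (* At t = - e and t = 1 - e the values of F are a and a - d, which cannot both be zero. *)
  apply/eqP => F0; have E0 := congr1 (fun r : {poly k} => r.[- e]) F0.
  have E1 := congr1 (fun r : {poly k} => r.[1 - e]) F0.
  move: E0 E1; rewrite /F !hornerE subrr expr0n /= !mul0r subr0 => ->.
  by rewrite sub0r [e + 1 - e]addrAC subrr add0r expr1n mul1r => /eqP; rewrite oppr_eq0; apply/negP.
have b0 : b = 0.
  apply: (@poly_ext_cofinite _ (F * ('X + e%:P))).
    by rewrite mulf_neq0 // -[e]opprK polyCN polyXsubC_eq0.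
  move=> t; rewrite horner0 hornerM mulf_eq0 negb_or !hornerE => /andP[Ft et].
  have hX : onX (cox 0 u1 (e + t) z) by rewrite onX_cox (negPf hu) andbF addrC (negPf et).
  have EX : ev 'X_iu0 (cox 0 u1 (e + t) z) = 0 by rewrite /cox !evE.
  have /eqP := h _ hX EX.
  rewrite eis_form_cox mulf_eq0 add0r -hb => /orP[|/eqP//].
  by move: Ft; rewrite /F !hornerE => /negPf ->.
by have := hb 0; rewrite addr0 b0 horner0.
Qed.

(** From u0^n G = F B, with F = [eis_form], divisibility of G is known only off the fibre u0 = 0.
    That fibre is not part of the curve, so B vanishes on it, and [fibre_div] trades a factor u0 for
    u1, a unit there; n rounds suffice. *)
Lemma eis_cancel n a b d l G B : bihomog a b G -> bihomog d l B ->
  a = (p + d)%N -> (b + n = c + l)%N ->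
  (forall q, onX q -> ev 'X_iu0 q ^+ n * ev G q = ev eis_form q * ev B q) ->
  exists B', bihomog d l B' /\
    forall q, onX q -> ev 'X_iu1 q ^+ n * ev G q = ev eis_form q * ev B' q.
Proof.
elim: n b G B => [|n IH] b G B hG hB ad bl h; first by exists B.
have [B1 [hB1 E1]] : exists B1, bihomog d l B1 /\
    forall q, onX q -> ev 'X_iu1 q * ev B q = ev 'X_iu0 q * ev B1 q.
  apply: fibre_div => //; apply: eis_fibre => q hq u00.
  by rewrite -h // u00 exprS !mul0r.
have hP : bihomog a (b + n.+1) ('X_iu0 ^+ n * ('X_iu1 * G) - eis_form * B1).
  apply: bihomogB.
    apply: (bihomog_eq (bihomogM (bihomogXn n (@bihomogu k _)) (bihomogM (@bihomogu k _) hG))); lia.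
  by apply: (bihomog_eq (bihomogM eis_form_bihomog hB1)); lia.
have [|||B2 [hB2 E2]] := IH b.+1 ('X_iu1 * G) B1 _ hB1 ad.
- exact: (bihomogM (@bihomogu k _) hG).
- lia.
- move=> q hq; apply/eqP; rewrite -subr_eq0; apply/eqP.
  have -> : ev 'X_iu0 q ^+ n * ev ('X_iu1 * G) q - ev eis_form q * ev B1 q =
    ev ('X_iu0 ^+ n * ('X_iu1 * G) - eis_form * B1) q by rewrite !evE.
  apply: ev_cox_dense hq => u0 u1 e z u00 e0.
  have hX : onX (cox u0 u1 e z) by rewrite onX_cox (negPf u00) (negPf e0).
  have EX : ev 'X_iu0 (cox u0 u1 e z) = u0 by rewrite /cox !evE.
  apply: (mulfI u00); rewrite mulr0 evB !evM evXn.
  have := h _ hX; have := E1 _ hX; rewrite EX => e1 e2.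
  rewrite mulrBr [u0 * (ev eis_form _ * _)]mulrCA -e1.
  have -> : u0 * (u0 ^+ n * (ev 'X_iu1 (cox u0 u1 e z) * ev G (cox u0 u1 e z))) =
    ev 'X_iu1 (cox u0 u1 e z) * (u0 ^+ n.+1 * ev G (cox u0 u1 e z)) by rewrite exprS; ring.
  by rewrite e2; ring.
- exists B2; split=> // q hq; have := E2 q hq; rewrite evM exprS => <-; ring.
Qed.

(** Homogenising h gives B with u0^n G = F B. The w-degree of h is at most a - p, so no power of x0
    appears as a denominator, and [eis_cancel] deals with the points where u0 = 0. *)
Lemma eis_dvd G a b : bihomog a b G -> (exists h, chart_poly G = h * eis) ->
  forall q, onX q -> exists A B, [/\ is_bihomog A, is_bihomog B, ev A q != 0 &
    forall q', onX q' -> ev A q' * ev G q' = ev eis_form q' * ev B q'].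
Proof.
move=> hG [h Eh] q hq.
have [h0|h0] := eqVneq h 0.
  exists 1, 0; split; [by exists 0%N, 0%N; apply: bihomog1
    |by exists 0%N, 0%N; apply: bihomog0|by rewrite ev1 oner_eq0|].
  move=> q' hq'; rewrite ev0 mulr0 (ev_chart_dense hG) ?mulr0 // => y w.
  by rewrite chart_polyP Eh h0 mul0r !horner0.
have sG : (size h + p <= a.+1)%N.
  have := size_chart_poly hG; rewrite Eh size_Mmonic ?monic_eisF // size_eisF //.
  by rewrite addnS.
have h1 : (0 < size h)%N by rewrite size_poly_gt0.
pose K := (a - p)%N; have aK : a = (p + K)%N by rewrite /K; lia.
have hK : (size h <= K.+1)%N by rewrite /K; lia.
(* M exceeds the y-degrees of the coefficients of h; the summand b makes c + N - b a true
   difference. *)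
pose M := (b + \max_(i < size h) size (h`_i)%R)%N; pose N := (K + M)%N.
have hM i : (size (h`_i)%R <= M)%N.
  have [hi|hi] := ltnP i (size h); last by rewrite nth_default // size_poly0.
  by apply: leq_trans (leq_addl _ _); apply: (@leq_bigmax _ (fun i : 'I_(size h) => size (h`_i)%R) (Ordinal hi)).
pose B : {mpoly k[3 + 2]} := \sum_(i < K.+1) \sum_(j < M) h`_i`_j *:
  ('X_ix2 ^+ i * 'X_ix0 ^+ (K - i) * ('X_iu1 ^+ j * 'X_iu0 ^+ (N - j))).
have hB : bihomog K N B.
  apply: bihomog_sum => i _ _; apply: bihomog_sum => j _ _; apply: bihomogZ.
  have := ltn_ord i; have := ltn_ord j => lj li.
  apply: (bihomog_eq (bihomogM (bihomogM (bihomogXn i (@bihomogx k _)) (bihomogXn (K - i) (@bihomogx k _)))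
   (bihomogM (bihomogXn j (@bihomogu k _)) (bihomogXn (N - j) (@bihomogu k _))))); rewrite /N; lia.
have EB y w : ev B (chart y w) = h.[w%:P].[y].
  rewrite /B !ev_sum (horner_coef_wide _ hK) horner_sum; apply: eq_bigr => i _.
  rewrite ev_sum hornerM -rmorphXn /= hornerC (horner_coef_wide _ (hM i)) mulr_suml.
  by apply: eq_bigr => j _; rewrite /chart /cox !evE !mul1r !expr1n; ring.
pose n := (c + N - b)%N; have bn : (b + n = c + N)%N by rewrite /n /N /M; lia.
have hP : bihomog a (b + n) ('X_iu0 ^+ n * G - eis_form * B).
  apply: bihomogB.
    by apply: (bihomog_eq (bihomogM (bihomogXn n (@bihomogu k _)) hG)); lia.
  by apply: (bihomog_eq (bihomogM eis_form_bihomog hB)).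
have E0 q' : onX q' -> ev 'X_iu0 q' ^+ n * ev G q' = ev eis_form q' * ev B q'.
  move=> hq'; apply/eqP; rewrite -subr_eq0; apply/eqP.
  have -> : ev 'X_iu0 q' ^+ n * ev G q' - ev eis_form q' * ev B q' =
    ev ('X_iu0 ^+ n * G - eis_form * B) q' by rewrite !evE.
  apply: (ev_chart_dense hP) hq' => y w; rewrite evB !evM evXn EB (chart_polyP G) Eh eis_form_chart.
  by rewrite !hornerM /chart /cox !evE expr1n; ring.
have [u00|u00] := eqVneq (ev 'X_iu0 q) 0; last first.
  exists ('X_iu0 ^+ n), B; split.
  - by exists (n * 0)%N, (n * 1)%N; apply: bihomogXn; apply: bihomogu.
  - by exists K, N.
  - by rewrite evXn expf_neq0.
  - by move=> q' hq'; rewrite evXn E0.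
have [B' [hB' E1]] := eis_cancel hG hB aK bn E0.
exists ('X_iu1 ^+ n), B'; split.
- by exists (n * 0)%N, (n * 1)%N; apply: bihomogXn; apply: bihomogu.
- by exists K, N.
- rewrite evXn expf_neq0 //; move: u00.
  have [u0 [u1 [e [z [-> hu hz]]]]] := onX_coxP hq.
  by rewrite /cox !evE => u00; move: hu; rewrite u00 eqxx.
- by move=> q' hq'; rewrite evXn E1.
Qed.

(** The remainder of the dehomogenised G modulo [eis] is nonzero of w-degree below p, hence coprime
    to [eis]. Bezout's identity yields a nonzero c2 in k[y] that vanishes at the y of every common
    zero in the chart, and each y admits finitely many w. *)
Lemma eis_finite G : is_bihomog G -> ~ (exists h, chart_poly G = h * eis) ->
  zfinite (fun q => eis_curve q /\ ev G q = 0).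
Proof.
move=> hG nd; have mF : eis \is monic by apply: monic_eisF.
pose r := chart_poly G %% eis.
have Er : chart_poly G = chart_poly G %/ eis * eis + r := Pdiv.IdomainMonic.divp_eq mF _.
have r0 : r != 0.
  by apply/eqP => r0; apply: nd; exists (chart_poly G %/ eis); rewrite {1}Er r0 addr0.
have rp : (size r <= p)%N.
  by rewrite -ltnS -(@size_eisF k p (p' + c)) // ltn_modp monic_neq0.
have /Bezout_coprimepP[[U V] /= /eqpP[[c1 c2] /= /andP[_ c20] Ec]] :
  coprimep eis r by apply: eisF_coprime.
have [ys hys] := poly_roots_seq c20.
have rts (d : k) (m : nat) : (0 < m)%N -> {s : seq k | forall w, w ^+ m = d -> w \in s}.
  move=> m0; have [|s hs] := @poly_roots_seq k ('X^m - d%:P).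
    by rewrite -size_poly_eq0 size_XnsubC.
  by exists s => w wd; apply: hs; rewrite rootE !hornerE wd subrr.
pose ws y := sval (rts (eisC k (p' + c)).[y] p isT).
have hws y : forall w, w ^+ p = (eisC k (p' + c)).[y] -> w \in ws y := svalP (rts _ p isT).
have [os hos] := @rts 1 p isT.
(* Outside the chart u0 = 0, since e = 0 alone would leave z^p u0^c = 0. The candidates there are
   the point of [E] and, if c = 0, the points where z / (e u1) is a p-th root of unity. *)
exists ([seq chart y w | y <- ys, w <- ws y] ++ cox 0 1 0 1 :: [seq cox 0 1 1 w | w <- os]).
move=> q [[hq]]; have [u0 [u1 [e [z [-> hu hz]]]]] := onX_coxP hq => Fq Gq.
have [u00|u00] := eqVneq u0 0.
  rewrite eis_form_cox u00 add0r in Fq; rewrite u00 eqxx /= in hu *.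
  have [e0|e0] := eqVneq e 0.
    rewrite e0 eqxx /= in hz *; exists (cox 0 1 0 1); first by rewrite mem_cat inE eqxx orbT.
    by exists z, u1; split=> //; rewrite /cox act_pt; congr pt; ring.
  have d0 : u1 * u1 ^+ (p' + c) != 0 by rewrite mulf_neq0 ?expf_neq0.
  have c0 : c = 0%N.
    move: Fq; case: (c) d0 => // c' d0 /eqP; rewrite expr0n mulr0 sub0r oppr_eq0 mulf_eq0.
    by rewrite (negPf d0) orbF expf_eq0 (negPf e0) andbF.
  exists (cox 0 1 1 (z / (e * u1))).
    rewrite mem_cat inE map_f ?orbT //; apply: hos.
    move: Fq; rewrite c0 expr0 mulr1 addn0 -exprS => /subr0_eq zE.
    by rewrite expr_div_n zE exprMn divff // mulf_neq0 // expf_neq0.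
  exists (e * u1), u1; rewrite hu mulf_neq0 //; split=> //; rewrite /cox act_pt.
  by congr pt; field; rewrite ?hu ?e0.
have e0 : e != 0.
  apply/eqP => e0; move: Fq; rewrite eis_form_cox e0 expr0n mul0r subr0 => /eqP.
  by rewrite mulf_eq0 !expf_eq0 (negPf u00) andbF orbF; move: hz; rewrite e0 eqxx /= => /negPf->.
set y := u1 / u0; set w := z / (e * u0).
have [a [b hab]] := hG.
have sc0 (i j : nat) (x : k) : (e * u0) ^+ i * u0 ^+ j * x = 0 -> x = 0.
  by move/eqP; rewrite !mulf_eq0 !expf_eq0 mulf_eq0 (negPf u00) (negPf e0) !andbF /= => /eqP.
have Fy : eis.[w%:P].[y] = 0.
  rewrite -eis_form_chart; apply: (sc0 p c).
  by rewrite -(ev_chart _ _ eis_form_bihomog).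
have Gy : (chart_poly G).[w%:P].[y] = 0.
  rewrite -chart_polyP; apply: (sc0 a b).
  by rewrite -(ev_chart _ _ hab).
have ry : r.[w%:P].[y] = 0.
  by move: Gy; rewrite {1}Er hornerD hornerM [X in X = _]hornerD hornerM Fy mulr0 add0r.
have yin : y \in ys.
  apply: hys; have := congr1 (fun s : {poly {poly k}} => s.[w%:P].[y]) Ec.
  rewrite !hornerZ hornerD (hornerM U) (hornerM V) -[X in c2 * X.[_]]polyC1 hornerC mulr1 hornerM hornerD !hornerM Fy ry !mulr0 addr0 mulr0 => /esym/eqP.
  by rewrite rootE.
have win : w \in ws y.
  apply: hws; move: Fy; rewrite /eis /eisF hornerD hornerN hornerC hornerXn -rmorphXn /=.
  by rewrite hornerD hornerN hornerC => /subr0_eq.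
exists (chart y w); first by rewrite mem_cat allpairs_f_dep.
exists (e * u0), u0; rewrite u00 mulf_neq0 //; split=> //; rewrite /chart /cox act_pt.
by rewrite /y /w; congr pt; field; rewrite ?u00 ?e0.
Qed.

Lemma eis_infinite : zinfinite eis_curve.
Proof.
apply: (@zinfinite_ratio k (fun q => ev 'X_iu1 q / ev 'X_iu0 q)).
  move=> l m q l0 m0; rewrite !(ev_act _ _ _ (@bihomogu k _)) expr0 expr1 !mul1r.
  by rewrite -mulf_div divff // mul1r.
move=> y; pose P : {poly k} := 'X^p - ((eisC k (p' + c)).[y])%:P.
have [|w /rootP Pw] := closed_rootP P _; first by rewrite size_XnsubC.
exists (chart y w); last by rewrite /chart /cox !evE divr1.
split; first by rewrite onX_cox oner_eq0.
rewrite eis_form_chart /eis /eisF hornerD hornerN hornerC hornerXn -rmorphXn /=.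
by move: Pw; rewrite /P !hornerD !hornerN !hornerC hornerXn.
Qed.

Lemma eis_closed : zclosed eis_curve.
Proof. by apply: zclosed_bihomog; exists p, c; apply: eis_form_bihomog. Qed.

Lemma eis_irreducible : irreducible_curve eis_curve.
Proof.
apply: irreducible_curve_crit eis_closed eis_infinite _ => G hG.
have [d|nd] := classic (exists h, chart_poly G = h * eis); last by right; apply: eis_finite.
left=> q [hq Fq]; have [a [b hab]] := hG.
have [A [B [_ _ A0 AB]]] := eis_dvd hab d hq.
by apply: (mulfI A0); rewrite AB // Fq mul0r mulr0.
Qed.

(** A form vanishing on this infinite curve escapes [eis_finite], so it falls under the divisible
    case of [eis_dvd]. *)
Lemma eis_class : has_class eis_curve ((p + c)%:Z, - c%:Z).
Proof.
exists (ev eis_form); split.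
- by apply: (sectionE eis_form_bihomog) => /=; lia.
- by move=> q [].
move=> G hG G0 q hq; have [a [b hab]] := hG.
apply: (eis_dvd hab) hq; apply: NNPP => nd.
apply: (@zinfiniteN _ eis_curve _ eis_infinite).
by apply: zfinite_sub (eis_finite hG nd) => q' Dq'; split=> //; apply: G0.
Qed.

End Curves.

(** * The numerical conditions *)

Definition eps (m : nat) : rat := 1 - m%:R^-1.

Lemma neglogKE m (c : cls) :
  neglogK m c = (3 - eps m * c.1%:~R, - 1 - eps m * c.2%:~R).
Proof.
rewrite /neglogK (_ : toQ KX = (- 3, 1)); last by [].
by rewrite /= -/(eps m); congr (_, _); rewrite /= opprD ?opprK.
Qed.

Lemma neglogK_E m (c : cls) : - (neglogK m c).2 = 1 + eps m * c.2%:~R.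
Proof. by rewrite neglogKE /=; ring. Qed.

Lemma neglogK_f m (c : cls) :
  (neglogK m c).1 + (neglogK m c).2 = 2 - eps m * (c.1 + c.2)%:~R.
Proof. by rewrite neglogKE /= intrD; ring. Qed.

Lemma eps2 : eps 2 = 1 / 2. Proof. by []. Qed.

Lemma eps_bounds m : (2 <= m)%N -> 1 / 2 <= eps m < 1.
Proof.
move=> m2; have m0 : (0 : rat) < m%:R by rewrite ltr0n; lia.
have h : (2 : rat) <= m%:R by rewrite ler_nat.
have : (0 : rat) < m%:R^-1 by rewrite invr_gt0.
have : m%:R^-1 <= (2^-1 : rat) by rewrite lef_pV2.
by rewrite /eps; lra.
Qed.

Lemma eps_ge4 m : (4 <= m)%N -> 3 / 4 <= eps m < 1.
Proof.
move=> m2; have m0 : (0 : rat) < m%:R by rewrite ltr0n; lia.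
have h : (4 : rat) <= m%:R by rewrite ler_nat.
have : (0 : rat) < m%:R^-1 by rewrite invr_gt0.
have : m%:R^-1 <= (4^-1 : rat) by rewrite lef_pV2.
by rewrite /eps; lra.
Qed.

(** For D.f = 3 the degree 2 - 3 eps on a fibre is positive at m = 2, zero at m = 3 and negative
    from m = 4 on. *)
Lemma eps_cases m : (2 <= m)%N ->
  [\/ m = 2%N /\ eps m = 1 / 2, m = 3%N /\ eps m = 2 / 3 | (4 <= m)%N /\ 3 / 4 <= eps m < 1].
Proof.
case: m => [|[|[|[|m]]]] // _; [by constructor 1|by constructor 2|constructor 3].
by split=> //; apply: eps_ge4.
Qed.

(** In the third case p' + 1 = D.f and n = D.E; these classes are realised by [eis_curve]. *)
Lemma table_classes c : c \in classes_a ++ classes_b ++ classes_c ++ classes_d ->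
  [\/ c = E, c = f | exists p' n : nat, c = ((p'.+1 + n)%:Z, - n%:Z)].
Proof.
have C3 (p' n : nat) : c = ((p'.+1 + n)%:Z, - n%:Z) ->
   [\/ c = E, c = f | exists p' n : nat, c = ((p'.+1 + n)%:Z, - n%:Z)].
  by move=> ->; constructor 3; exists p', n.
rewrite !mem_cat !inE => /or4P[].
- move=> /or4P[/eqP->|/eqP->|/eqP->|/or3P[] /eqP Ec]; [by constructor 1|by constructor 2| | | |].
  + by constructor 3; exists 0%N, 0%N.
  + by apply: (C3 0%N 1%N).
  + by apply: (C3 1%N 0%N).
  + by apply: (C3 1%N 1%N).
- move=> /orP[] /eqP Ec; [by apply: (C3 2%N 0%N)|by apply: (C3 2%N 1%N)].
- move=> /or3P[] /eqP Ec; [by apply: (C3 0%N 2%N)|by apply: (C3 1%N 2%N)|by apply: (C3 2%N 2%N)].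
- move=> /or3P[] /eqP Ec; [by apply: (C3 3%N 0%N)|by apply: (C3 3%N 1%N)|by apply: (C3 3%N 2%N)].
Qed.

(** Besides [E] and [f], the tables hold the twelve classes with D.E = j in {0, 1, 2} and D.f = n in
    {1, 2, 3, 4}. *)
Lemma classes_tableE c : (c \in classes_a ++ classes_b ++ classes_c ++ classes_d) =
  (c \in [:: E; f] ++ [seq (n%:Z + j%:Z, - j%:Z) | j <- iota 0 3, n <- iota 1 4]).
Proof.
rewrite /classes_a /classes_b /classes_c /classes_d; apply/idP/idP;
rewrite !inE /=; do ?(case/orP => [->|]; rewrite ?orbT //); by move=> ->; rewrite ?orbT.
Qed.

Theorem propositionC1 (k : closedFieldType) (k_char0 : [pchar k] =i pred0) :
  (forall (D : subX k) (c : cls) (m : nat),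
     irreducible_curve D -> has_class D c -> (2 <= m)%N ->
     Qnef k (neglogK m c) ->
     c \in classes_a ++ classes_b ++ classes_c ++ classes_d)
  /\ (forall r, r \in table_a ++ table_b ++ table_c ++ table_d ->
        numbers r.1 = r.2)
  /\ (KX = - (H *+ 3 - E) /\ KX *- 2 = H *+ 6 - E *+ 2)
  /\ (forall c, c \in classes_a -> forall m : nat, (2 <= m)%N ->
        Qample k (neglogK m c))
  /\ (forall c, c \in classes_b -> forall m : nat, (2 <= m)%N ->
        [/\ Qample k (neglogK m c) <-> m = 2%N,
            Qnef k (neglogK m c) <-> (m = 2%N \/ m = 3%N) &
            Qbig k (neglogK m c) <-> m = 2%N])
  /\ (forall c, c \in classes_c ->
        (forall m : nat, (2 <= m)%N ->
           (Qnef k (neglogK m c) <-> m = 2%N) /\ ~ Qample k (neglogK m c))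
        /\ Qbig k (neglogK 2 c))
  /\ (forall c, c \in classes_d ->
        (forall m : nat, (2 <= m)%N ->
           (Qnef k (neglogK m c) <-> m = 2%N) /\ ~ Qample k (neglogK m c))
        /\ ~ Qbig k (neglogK 2 c))
  /\ (forall c, c \in classes_a ++ classes_b ++ classes_c ++ classes_d ->
        exists D : subX k, irreducible_curve D /\ has_class D c)
  /\ (forall (D : subX k) (c : cls) (m : nat),
        irreducible_curve D -> has_class D c -> (2 <= m)%N ->
        (Qample k (neglogK m c) <->
           c \in classes_a \/ (c \in classes_b /\ m = 2%N))).
Proof.
have nefE m c : Qnef k (neglogK m c) <->
    0 <= 1 + eps m * c.2%:~R /\ 0 <= 2 - eps m * (c.1 + c.2)%:~R.
  by rewrite Qnef_numeric neglogK_E neglogK_f.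
have ampE m c : Qample k (neglogK m c) <->
    0 < 1 + eps m * c.2%:~R /\ 0 < 2 - eps m * (c.1 + c.2)%:~R.
  by rewrite QampleE neglogK_E neglogK_f.
have bigE m c : 0 <= 1 + eps m * c.2%:~R ->
    Qbig k (neglogK m c) <-> 0 < 2 - eps m * (c.1 + c.2)%:~R.
  by move=> h; rewrite QbigE ?neglogK_E // neglogK_f.
have mem (D : subX k) (c : cls) m : irreducible_curve D -> has_class D c -> (2 <= m)%N ->
    Qnef k (neglogK m c) -> c \in classes_a ++ classes_b ++ classes_c ++ classes_d.
  move=> hD hc m2 /nefE[h1 h2]; rewrite classes_tableE.
  have /andP[e1 e2] := eps_bounds m2.
  have [->|[->|[c1 c2]]] := irreducible_curve_class hD hc => //.
  (* As eps >= 1/2, the degrees 1 - eps (D.E) and 2 - eps (D.f) are negative once D.E >= 3 or D.f >=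
     5. *)
  have c3 : -3 < c.2.
    rewrite -(ltr_int rat); apply: contraTT h1; rewrite -leNgt -ltNge => h.
    have : eps m * c.2%:~R <= eps m * (-3)%:~R by rewrite ler_wpM2l //; lra.
    by rewrite (_ : (-3)%:~R = -3 :> rat) //; lra.
  have c4 : c.1 + c.2 < 5.
    rewrite -(ltr_int rat); apply: contraTT h2; rewrite -leNgt -ltNge => h.
    have : eps m * 5%:~R <= eps m * (c.1 + c.2)%:~R by rewrite ler_wpM2l //; lra.
    by rewrite (_ : 5%:~R = 5 :> rat) //; lra.
  rewrite mem_cat; apply/orP; right; apply/allpairsP.
  exists (absz c.2, absz (c.1 + c.2)); rewrite !mem_iota /=.
  by split; [lia|lia|case: (c) c1 c2 c3 c4 => a b /= *; congr (_, _); lia].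
have dataP (P : pred cls) (s : seq cls) : all P s -> forall c, c \in s -> P c.
  by move=> /allP.
have epsM m (x y : int) : (2 <= m)%N -> x <= y -> eps m * x%:~R <= eps m * y%:~R.
  by move=> /eps_bounds /andP[e1 _] xy; rewrite ler_wpM2l ?ler_int //; lra.
have im2 : (-2)%:~R = -2 :> rat by [].
have i2 : 2%:~R = 2 :> rat by [].
have i3 : 3%:~R = 3 :> rat by [].
have i4 : 4%:~R = 4 :> rat by [].
(* Here D.E <= 1 and D.f <= 2, so eps < 1 makes both degrees positive. *)
have clA (c : cls) m : c \in classes_a -> (2 <= m)%N -> Qample k (neglogK m c).
  move=> hc m2; have /andP[c1 c2] : (-1 <= c.2) && (c.1 + c.2 <= 2).
    by apply: (dataP (fun c : cls => (-1 <= c.2) && (c.1 + c.2 <= 2)) classes_a).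
  have h1 := epsM m _ _ m2 c1; have h2 := epsM m _ _ m2 c2; have /andP[e1 e2] := eps_bounds m2.
  by rewrite mulrN1z in h1; rewrite i2 in h2; rewrite ampE; split; lra.
(* D.E <= 1 keeps the degree on [E] positive, so everything depends on the sign of 2 - 3 eps. *)
have clB (c : cls) m : c \in classes_b -> (2 <= m)%N ->
    [/\ Qample k (neglogK m c) <-> m = 2%N,
        Qnef k (neglogK m c) <-> (m = 2%N \/ m = 3%N) &
        Qbig k (neglogK m c) <-> m = 2%N].
  move=> hc m2; have /andP[c1 /eqP c2] : (-1 <= c.2) && (c.1 + c.2 == 3).
    by apply: (dataP (fun c : cls => (-1 <= c.2) && (c.1 + c.2 == 3)) classes_b).
  have h1 := epsM m _ _ m2 c1; have /andP[e1 e2] := eps_bounds m2; rewrite mulrN1z in h1.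
  have h2 : 0 < 1 + eps m * c.2%:~R by lra.
  have hB := bigE m c (ltW h2); have hN := nefE m c; have hA := ampE m c.
  rewrite c2 i3 in hA hN hB; clear - hA hN hB h2 m2.
  have [[Em e]|[Em e]|[m4 /andP[e3 _]]] := eps_cases m2;
  split; [rewrite hA|rewrite hN|rewrite hB|rewrite hA|rewrite hN|rewrite hB
    |rewrite hA|rewrite hN|rewrite hB]; split=> h.
  - by [].
  - by split; lra.
  - by left.
  - by split; lra.
  - by [].
  - by lra.
  - by case: h => _ h; exfalso; lra.
  - by rewrite Em in h.
  - by right.
  - by split; lra.
  - by exfalso; lra.
  - by rewrite Em in h.
  - by case: h => _ h; exfalso; lra.
  - by rewrite h in m4.
  - by case: h => _ h; exfalso; lra.
  - by case: h => h; rewrite h in m4.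
  - by exfalso; lra.
  - by rewrite h in m4.
(* D.E = 2, and 1 - 2 eps is zero at m = 2 and negative afterwards; the degree on a fibre is still
   positive at m = 2. *)
have clC (c : cls) : c \in classes_c -> (forall m : nat, (2 <= m)%N ->
     (Qnef k (neglogK m c) <-> m = 2%N) /\ ~ Qample k (neglogK m c)) /\ Qbig k (neglogK 2 c).
  move=> hc; have /andP[/eqP c1 c2] : (c.2 == -2) && (c.1 + c.2 <= 3).
    by apply: (dataP (fun c : cls => (c.2 == -2) && (c.1 + c.2 <= 3)) classes_c).
  have h2 := epsM 2%N _ _ isT c2; rewrite i3 eps2 in h2; split; last first.
    have h0 : 0 <= 1 + eps 2 * c.2%:~R by rewrite c1 im2 eps2; lra.
    by apply/(bigE _ _ h0); rewrite eps2; lra.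
  move=> m m2; rewrite ampE nefE c1 im2; rewrite c1 in h2.
  have /andP[e1 _] := eps_bounds m2; split; last by case=> *; lra.
  have [[Em e]|[Em e]|[m4 /andP[e3 _]]] := eps_cases m2; split=> h.
  - exact: Em.
  - by rewrite Em eps2; split; lra.
  - by case: h => *; exfalso; lra.
  - by rewrite Em in h.
  - by case: h => *; exfalso; lra.
  - by rewrite h in m4.
(* D.f = 4, and 2 - 4 eps is zero at m = 2, which excludes bigness there, and negative
   afterwards. *)
have clD (c : cls) : c \in classes_d -> (forall m : nat, (2 <= m)%N ->
     (Qnef k (neglogK m c) <-> m = 2%N) /\ ~ Qample k (neglogK m c)) /\ ~ Qbig k (neglogK 2 c).
  move=> hc; have /andP[c1 /eqP c2] : (-2 <= c.2) && (c.1 + c.2 == 4).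
    by apply: (dataP (fun c : cls => (-2 <= c.2) && (c.1 + c.2 == 4)) classes_d).
  have h1 := epsM 2%N _ _ isT c1; rewrite im2 eps2 in h1; split; last first.
    have h0 : 0 <= 1 + eps 2 * c.2%:~R by rewrite eps2; lra.
    by move/(bigE _ _ h0); rewrite c2 i4 eps2; lra.
  move=> m m2; rewrite ampE nefE c2 i4.
  have /andP[e1 _] := eps_bounds m2; split; last by case=> *; lra.
  have [[Em e]|[Em e]|[m4 /andP[e3 _]]] := eps_cases m2; split=> h.
  - exact: Em.
  - by rewrite Em eps2; split; lra.
  - by case: h => *; exfalso; lra.
  - by rewrite Em in h.
  - by case: h => *; exfalso; lra.
  - by rewrite h in m4.
have nat0 n : (n%:R == 0 :> k) = (n == 0)%N by move/pcharf0P: k_char0 => ->.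
split; first exact: mem.
split.
  move=> r hr; apply/eqP; move: r hr; apply/allP; vm_compute; reflexivity.
split; first by [].
split; first by move=> c hc m; apply: clA.
split; first by move=> c hc m; apply: clB.
split; first exact: clC.
split; first exact: clD.
split.
  move=> c /table_classes[->|->|[p' [n ->]]].
  - by exists (@Ecurve k); split; [apply: Ecurve_irreducible|apply: Ecurve_class].
  - exists (Fcurve 0 1); split; last exact: Fcurve_class.
    exact: Fcurve_irreducible (nz2_1r _).
  - have t0 : (2 : k) != 0 by rewrite nat0.
    (* 2^(p' + 1) - 1 is a positive integer, hence nonzero in characteristic 0. *)
    have tp : (2 : k) ^+ p'.+1 != 1.
      rewrite -natrX -subr_eq0 -(natrB _ (n := 1)) ?expn_gt0 // nat0.
      by rewrite subn_eq0 -ltnNge -(expn0 2) ltn_exp2l.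
    by exists (@eis_curve k p' n); split; [apply: eis_irreducible|apply: eis_class].
move=> D c m hD hc m2; split.
  move=> ha; have hm : c \in classes_a ++ classes_b ++ classes_c ++ classes_d.
    apply: mem hD hc m2 _; apply/nefE; move/ampE: ha => [h1 h2].
    by split; apply: ltW.
  move: hm; rewrite !mem_cat => /or4P[hm|hm|/clC[h _]|/clD[h _]].
  - by left.
  - by right; split=> //; have [h _ _] := clB _ _ hm m2; apply/h.
  - by have [_ nh] := h m m2; case: nh.
  - by have [_ nh] := h m m2; case: nh.
move=> [hm|[hm m2']]; first exact: clA.
by have [h _ _] := clB _ _ hm m2; apply/h.
Qed.
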